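(* Let $T$ be an o-minimal theory with monster model $\mathbb{M}$, and assume there are $0$-definable unary functions $f_1,\ldots,f_k$ such that for every set $A\subseteq\mathbb{M}$, $\mathrm{dcl}(A)=f_1(A)\cup\cdots\cup f_k(A)\cup\mathrm{dcl}(\emptyset)$. If $(\mathbb{M},\mathbb{H})$ is the monster model of the theory $T^{\mathrm{indep}}$ of $H$-structures of $T$, then $o(\mathbb{H})=e(\mathbb{H})$.
   Context: Conventions. $T$ is a complete first-order theory in a language $L$ with an infinite model. Fix a strongly inaccessible cardinal $\lambda>|L|$; the monster model of a complete theory is its saturated model of cardinality $\lambda$ (unique up to isomorphism), and ''small'' means of cardinality $<\lambda$. For $\mathbb{D}\subseteq\mathbb{M}$, $(\mathbb{M},\mathbb{D})$ is the expansion of $\mathbb{M}$ by a new predicate interpreted as $\mathbb{D}$, and $o(\mathbb{D})=\{\mathbb{D}'\subseteq\mathbb{M}\mid(\mathbb{M},\mathbb{D})\cong(\mathbb{M},\mathbb{D}')\}=\{f(\mathbb{D})\mid f\in\mathrm{Aut}(\mathbb{M})\}$, $e(\mathbb{D})=\{\mathbb{D}'\subseteq\mathbb{M}\mid(\mathbb{M},\mathbb{D})\equiv(\mathbb{M},\mathbb{D}')\}$. An o-minimal theory is the complete theory of a densely ordered o-minimal structure; in such a theory $\mathrm{dcl}=\mathrm{acl}$, and o-minimal theories are geometric ($\mathrm{acl}$ satisfies exchange in models of $T$ and $T$ eliminates $\exists^\infty$). ''$0$-definable'' means definable without parameters. $H$-structures. Let $T$ be geometric and $L_H=L\cup\{H\}$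 with $H$ a new unary predicate. An $L_H$-structure $(M,H(M))$ with $M\models T$ is an $H$-structure if $H(M)$ is an algebraically independent set and: (Density) for every finite $A\subseteq M$, every non-algebraic $L$-type $q(x)\in S_1(A)$ has a realization in $H(M)$; (Extension) for every finite $A\subseteq M$, every non-algebraic $L$-type $q(x)\in S_1(A)$ has a realization $a\in M$ with $a\notin\mathrm{acl}(A\cup H(M))$. Here $\mathrm{acl}$ is in the sense of $L$. All $H$-structures of $T$ are elementarily equivalent; their common complete theory is denoted $T^{\mathrm{indep}}$ (the theory of $H$-structures of $T$). It is axiomatized by $T$ together with: the elements of $H$ are algebraically independent; if $\varphi(\bar a,x)$ ($\varphi\in L$) has infinitely many solutions, it has a solution in $H$; if $\varphi(\bar a,x)$ has infinitely many solutions and, for every $\bar y$, $\psi(\bar a,\bar y,x)$ has fewer than $k$ solutions, then some solution $x$ of $\varphi(\bar a,x)$ satisfies $\neg\psi(\bar a,\bar y,x)$ for all $\bar y$ from $H$ ($\varphi,\psi\in L$). Every $\omega$-saturated model of $T^{\mathrm{indep}}$ is an $H$-structure. The $L$-reduct of the monster model of $T^{\mathrm{indep}}$ is identified with $\mathbb{M}$, and $\mathbb{H}=H(\mathbb{M})$. *)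

(* Defs.v *)
From mathcomp Require Import all_boot.
From mathcomp Require Import boolp classical_sets functions cardinality.

Set Implicit Arguments.
Unset Strict Implicit.
Unset Printing Implicit Defensive.

Local Open Scope classical_set_scope.
Local Open Scope card_scope.

(** * First-order logic *)

Record language := Language {
  fsym : nat -> Type;
  rsym : nat -> Type
}.

Section Syntax.
Variable L : language.

(* In [term n] and [formula n] the variables are indexed by 'I_n; a quantifier
   binds the variable 0 of its body. *)
Inductive term (n : nat) : Type :=
| Var of 'I_n
| App m of fsym L m & ('I_m -> term n).

Inductive formula : nat -> Type :=
| Bot n : formula n
| Equal n of term n & term n : formula n
| Rel n m of rsym L m & ('I_m -> term n) : formula n
| Imp n of formula n & formula n : formula n
| All n of formula n.+1 : formula n.

Definition Neg n (phi : formula n) : formula n := Imp phi (Bot n).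

Definition sentence := formula 0.

Record structure := Structure {
  carrier :> Type;
  carrier_inhabited : inhabited carrier;
  fint : forall n, fsym L n -> ('I_n -> carrier) -> carrier;
  rint : forall n, rsym L n -> ('I_n -> carrier) -> Prop
}.

End Syntax.

Arguments Var {L n}.
Arguments App {L n m}.
Arguments Bot {L}.
Arguments fint {L} _ {n}.
Arguments rint {L} _ {n}.

Definition scons (M : Type) n (x : M) (v : 'I_n -> M) (i : 'I_n.+1) : M :=
  if unlift ord0 i is Some j then v j else x.

Fixpoint eval L (M : structure L) n (v : 'I_n -> M) (t : term L n) : M :=
  match t with
  | Var i => v i
  | App _ s a => fint M s (fun i => eval v (a i))
  end.

Fixpoint sat L (M : structure L) n (phi : formula L n) : ('I_n -> M) -> Prop :=
  match phi with
  | Bot _ => fun=> False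
  | Equal _ t u => fun v => eval v t = eval v u
  | Rel _ _ r a => fun v => rint M r (fun i => eval v (a i))
  | Imp _ p q => fun v => sat p v -> sat q v
  | All _ p => fun v => forall x : M, sat p (scons x v)
  end.

Definition holds L (M : structure L) (phi : sentence L) : Prop :=
  sat phi (tnth [tuple] : 'I_0 -> M).

Definition theory_of L (M : structure L) : set (sentence L) :=
  [set phi | holds M phi].

Definition is_model L (M : structure L) (T : set (sentence L)) : Prop :=
  T `<=` theory_of M.

Definition elem_equiv L (M N : structure L) : Prop :=
  theory_of M = theory_of N.

Definition is_iso L (M N : structure L) (f : M -> N) : Prop :=
  [/\ bijective f,
      forall n (s : fsym L n) v, f (fint M s v) = fint N s (f \o v) &
      forall n (r : rsym L n) v, rint M r v <-> rint N r (f \o v)].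

Definition isomorphic L (M N : structure L) : Prop :=
  exists f : M -> N, is_iso f.

(** * Definability with parameters, types, algebraic and definable closure *)

Section Definability.
Variables (L : language) (M : structure L).

(* A formula in one free variable (the variable 0) with parameters in M *)
Record pformula := PFormula {
  pf_arity : nat;
  pf_formula : formula L pf_arity.+1;
  pf_param : 'I_pf_arity -> M
}.

Definition solutions (phi : pformula) : set M :=
  [set x | sat (pf_formula phi) (scons x (@pf_param phi))].

Definition pf_neg (phi : pformula) : pformula :=
  PFormula (Neg (pf_formula phi)) (@pf_param phi).

Definition over (A : set M) : set pformula :=
  [set phi | forall i, A (@pf_param phi i)].

Definition realizes (q : set pformula) (x : M) : Prop :=
  forall phi, q phi -> solutions phi x.

(* [is_type A q] is q(x) \in S_1(A).  By compactness, consistency with the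
   elementary diagram of M amounts to finite satisfiability in M. *)
Definition is_type (A : set M) (q : set pformula) : Prop :=
  [/\ q `<=` over A,
      forall F : set pformula, finite_set F -> F `<=` q ->
        exists x, realizes F x &
      forall phi, over A phi -> q phi \/ q (pf_neg phi)].

Definition algebraic_type (q : set pformula) : Prop :=
  exists2 phi, q phi & finite_set (solutions phi).

Definition acl (A : set M) : set M :=
  [set b | exists phi,
     [/\ over A phi, finite_set (solutions phi) & solutions phi b]].

Definition dcl (A : set M) : set M :=
  [set b | exists2 phi, over A phi & solutions phi = [set b]].

Definition alg_independent (A : set M) : Prop :=
  forall a, A a -> ~ acl (A `\ a) a.

Definition definable0_fun (f : M -> M) : Prop :=
  exists phi : formula L 2,
    forall x y, sat phi (tnth [tuple x; y]) <-> y = f x.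

End Definability.

(** * Monster models *)

Definition card_lt T U (A : set T) (B : set U) : Prop := ~ (B #<= A).

(* The cardinal lambda is represented by a type of that cardinality. *)
Definition strongly_inaccessible (lambda : Type) : Prop :=
  [/\ ~ countable [set: lambda],
      forall A : set lambda, card_lt A [set: lambda] ->
        card_lt [set B | B `<=` A] [set: lambda] &
      forall (I : set lambda) (F : lambda -> set lambda),
        card_lt I [set: lambda] ->
        (forall i, I i -> card_lt (F i) [set: lambda]) ->
        card_lt (\bigcup_(i in I) F i) [set: lambda]].

Definition saturated L (M : structure L) : Prop :=
  forall A : set M, card_lt A [set: M] ->
  forall q : set (pformula M), is_type A q -> exists x, realizes q x.

Definition is_monster (lambda : Type) L (T : set (sentence L))
    (M : structure L) : Prop :=
  [/\ is_model M T, [set: M] #= [set: lambda] & saturated M].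

(* |L| is, as usual, the number of L-formulas. *)
Definition language_card_lt L (lambda : Type) : Prop :=
  card_lt [set: {n & formula L n}] [set: lambda].

(** * O-minimality *)

Section OMinimal.
Variables (L : language) (lt : rsym L 2) (M : structure L).

Definition slt (x y : M) : Prop := rint M lt (tnth [tuple x; y]).

(* [None] stands for -oo as a lower bound and for +oo as an upper bound. *)
Definition open_interval (a b : option M) : set M :=
  [set x | (if a is Some a then slt a x else True) /\
           (if b is Some b then slt x b else True)].

Definition interval_or_point (I : set M) : Prop :=
  (exists a b, I = open_interval a b) \/ (exists a, I = [set a]).

Definition dense_linear_order : Prop :=
  [/\ forall x, ~ slt x x,
      forall x y z, slt x y -> slt y z -> slt x z,
      forall x y, [\/ slt x y, x = y | slt y x] &
      forall x y, slt x y -> exists z, slt x z /\ slt z y].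

Definition o_minimal : Prop :=
  forall phi : pformula M, exists F : set (set M),
    [/\ finite_set F, F `<=` interval_or_point &
        solutions phi = \bigcup_(I in F) I].

End OMinimal.

Definition o_minimal_theory L (T : set (sentence L)) : Prop :=
  exists (lt : rsym L 2) (N : structure L),
    [/\ dense_linear_order lt N, o_minimal lt N & T = theory_of N].

(** * Expansions by a unary predicate *)

Inductive expand_rsym (L : language) : nat -> Type :=
| OldRel n of rsym L n : expand_rsym L n
| NewPred : expand_rsym L 1.

Definition expand (L : language) : language :=
  Language (fsym L) (expand_rsym L).

Definition expand_rint L (M : structure L) (D : set M) n
    (r : expand_rsym L n) : ('I_n -> M) -> Prop :=
  match r with
  | OldRel _ r => rint M r
  | NewPred => fun v => D (v ord0)
  end.

Definition expansion L (M : structure L) (D : set M) : structure (expand L) :=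
  @Structure (expand L) M (carrier_inhabited M) (@fint L M)
    (@expand_rint L M D).

Definition o_class L (M : structure L) (D : set M) : set (set M) :=
  [set D' | isomorphic (expansion D) (expansion D')].

Definition e_class L (M : structure L) (D : set M) : set (set M) :=
  [set D' | elem_equiv (expansion D) (expansion D')].

Lemma o_classE L (M : structure L) (D : set M) :
  o_class D = [set D' | exists2 f : M -> M, is_iso f & D' = f @` D].
Proof.
apply/seteqP; split=> D' [f].
  case=> bijf ff fr; exists f.
    split=> // n r v; exact: (fr n (OldRel r) v).
  have [g fK gK] := bijf.
  have fD x : D x <-> D' (f x) := fr 1 (NewPred L) (fun=> x).
  apply/seteqP; split=> [y D'y|_ [x Dx <-]]; last exact/fD.
  by exists (g y); rewrite ?gK //; apply/fD; rewrite gK.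
move=> [bijf ff fr] ->; exists f; split=> // n r.
case: r => [m r|] v; first exact: fr.
split=> [Dv|/= [x Dx /(bij_inj bijf) <-]//].
by exists (v ord0).
Qed.

(** * H-structures *)

Definition is_H_structure L (T : set (sentence L)) (M : structure L)
    (H : set M) : Prop :=
  [/\ is_model M T,
      alg_independent H,
      forall A : set M, finite_set A ->
        forall q, is_type A q -> ~ algebraic_type q ->
        exists2 a, H a & realizes q a &
      forall A : set M, finite_set A ->
        forall q, is_type A q -> ~ algebraic_type q ->
        exists2 a, ~ acl (A `|` H) a & realizes q a].

Definition T_indep L (T : set (sentence L)) : set (sentence (expand L)) :=
  [set phi | forall (M : structure L) (H : set M),
     is_H_structure T H -> holds (expansion H) phi].

(* Main.v *)
(* In a monster model M of T, an infinite set X definable over a small set A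
   contains an interval: otherwise each element of X has a successor in X with
   which it is interdefinable over A, so that a point of X outside dcl(A) has
   infinitely many elements in its closure over A, against
   dcl(Aa) = dcl(A) U {f_1(a), ..., f_k(a)}. The same fact gives exchange, and,
   by saturation, a whole interval of realizations of any non-algebraic type
   over a small set. The axioms of T^indep for intervals and for the f_i then
   show that, if (M,D) is elementarily equivalent to (M,H), every non-algebraic
   type over a small set is realized both in D and outside dcl(D), although
   (M,D) is not known to be saturated. Hence a back-and-forth of length lambda between
   (M,H) and (M,D) never gets stuck. It is carried by small partial elementary
   maps which respect the predicates on the definable closure of their
   domain. *)

Require Import Defs.
From mathcomp Require Import all_boot.
From mathcomp Require Import boolp classical_sets functions cardinality.
From mathcomp Require Import filter wochoice.

Set Implicit Arguments.
Unset Strict Implicit.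
Unset Printing Implicit Defensive.

Local Open Scope classical_set_scope.
Local Open Scope card_scope.

(** The obstacle is that a type over an infinite small set is not a single formula, so the axioms
    satisfied by (M,D) do not directly realize it in D. Saturation of M alone removes the obstacle:
    an interval of realizations replaces the type by one formula, whose only parameters are two
    endpoints. The hypothesis on dcl does the same for dcl(D): outside dcl(empty) it is a union of k
    images f_i(D), so avoiding it inside an interval is one sentence of the expanded language.
    Independence enters through two consequences: D misses dcl(empty), and no f_i sends a point of D
    to another point of D. With exchange, they decide which of the points f_i(a), definable once a
    new point a has been added, belong to D. O-minimality is given in some model of T, not in M, and
    is not a single sentence for each formula. What is carried over to M is a weaker statement on
    how a nonempty definable set begins on the left. *)

Lemma scons0 (X : Type) n (x : X) (v : 'I_n -> X) : scons x v ord0 = x.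
Proof. by rewrite /scons unlift_none. Qed.

Lemma sconsS (X : Type) n (x : X) (v : 'I_n -> X) i :
  scons x v (lift ord0 i) = v i.
Proof. by rewrite /scons liftK. Qed.

Lemma comp_scons (X Y : Type) (g : X -> Y) n (x : X) (v : 'I_n -> X) :
  g \o scons x v = scons (g x) (g \o v).
Proof. by apply/funext => i; rewrite /scons /=; case: unlift. Qed.

Lemma scons_eta (X : Type) n (w : 'I_n.+1 -> X) :
  scons (w ord0) (w \o lift ord0) = w.
Proof.
by apply/funext => i; rewrite /scons; case: unliftP => [j ->|->].
Qed.

Lemma ord0_fun_eq (X : Type) (v w : 'I_0 -> X) : v = w.
Proof. by apply/funext => -[]. Qed.

Lemma scons1E (X : Type) (x : X) (v : 'I_0 -> X) : scons x v = fun=> x.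
Proof. by rewrite -(scons_eta (fun=> x)); congr scons; apply: ord0_fun_eq. Qed.

(** * Renaming and definability *)

Section Renaming.
Variable L : language.

Fixpoint ren_term n m (r : 'I_n -> 'I_m) (t : term L n) : term L m :=
  match t with
  | Var i => Var (r i)
  | App _ s a => App s (fun i => ren_term r (a i))
  end.

Definition up_ren n m (r : 'I_n -> 'I_m) : 'I_n.+1 -> 'I_m.+1 :=
  scons ord0 (lift ord0 \o r).

Fixpoint ren n (phi : formula L n) : forall m, ('I_n -> 'I_m) -> formula L m :=
  match phi with
  | Bot _ => fun m _ => Bot m
  | Equal _ t u => fun _ r => Equal (ren_term r t) (ren_term r u)
  | Rel _ _ R a => fun _ r => Rel R (fun i => ren_term r (a i))
  | Imp _ p q => fun _ r => Imp (ren p r) (ren q r)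
  | All _ p => fun _ r => All (ren p (up_ren r))
  end.

Lemma eval_ren (M : structure L) n m (r : 'I_n -> 'I_m) (t : term L n)
    (v : 'I_m -> M) : eval v (ren_term r t) = eval (v \o r) t.
Proof.
by elim: t => //= k s a IH; congr (fint M s); apply/funext => i.
Qed.

Lemma scons_up_ren (X : Type) n m (x : X) (w : 'I_m -> X) (r : 'I_n -> 'I_m) :
  scons x w \o up_ren r = scons x (w \o r).
Proof.
rewrite /up_ren comp_scons scons0; congr scons.
by apply/funext => i /=; rewrite sconsS.
Qed.

Lemma sat_ren (M : structure L) n (phi : formula L n) m (r : 'I_n -> 'I_m)
    (v : 'I_m -> M) : sat (ren phi r) v <-> sat phi (v \o r).
Proof.
elim: phi m r v => {n} [n|n t u|n k R a|n p IHp q IHq|n p IHp] m r v //=.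
- by rewrite !eval_ren.
- rewrite (_ : (fun i => _) = (fun i => eval (v \o r) (a i))) //.
  by apply/funext => i; rewrite eval_ren.
- by rewrite IHp IHq.
- by split=> H x; move: (H x); rewrite IHp scons_up_ren.
Qed.

End Renaming.

(* A predicate on environments is definable when a single formula defines it in
   all the structures [S i]: pairs of structures give transfer statements, and
   a constant family with parameters in [K] gives the definable sets of a
   structure. *)
Section Definable.
Variables (L : language) (I : Type) (S : I -> structure L).
Variable K : set (forall i, S i).

Definition atom (t : forall i, (nat -> S i) -> S i) : Prop :=
  (exists j, t = fun i e => e j) \/ (exists2 c, K c & t = fun i e => c i).

(** Environments are indexed by [nat], so predicates in different numbers of variables combine
    freely; the atoms [t] select the entries and constants read by the finitely many variables of
    [phi]. *)
Definition dfn (P : forall i, (nat -> S i) -> Prop) : Prop :=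
  exists n (phi : formula L n) (t : 'I_n -> forall i, (nat -> S i) -> S i),
    (forall k, atom (t k)) /\ forall i e, P i e <-> sat phi (fun k => t k i e).

Definition push (X : Type) (x : X) (e : nat -> X) (j : nat) : X :=
  if j is j'.+1 then e j' else x.

Lemma atom_var j : atom (fun i e => e j). Proof. by left; exists j. Qed.

Lemma atom_const c : K c -> atom (fun i e => c i).
Proof. by move=> Kc; right; exists c. Qed.

Lemma dfn_ext P Q : dfn P -> (forall i e, P i e <-> Q i e) -> dfn Q.
Proof.
move=> [n [phi [t [at_ Pt]]]] PQ; exists n, phi, t; split=> // i e.
by rewrite -PQ Pt.
Qed.

Lemma dfn_sat n (phi : formula L n) t : (forall k, atom (t k)) ->
  dfn (fun i e => sat phi (fun k => t k i e)).
Proof. by move=> at_; exists n, phi, t. Qed.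

Lemma dfn_false : dfn (fun i e => False).
Proof.
by exists 1, (Bot 1), (fun _ i e => e 0); split=> // _; apply: atom_var.
Qed.

Lemma dfn_imp P Q : dfn P -> dfn Q -> dfn (fun i e => P i e -> Q i e).
Proof.
move=> [n [p [t [ht Pt]]]] [m [q [u [hu Qu]]]].
exists (n + m), (Imp (ren p (@lshift n m)) (ren q (@rshift n m))).
exists (fun k => match fintype.split k with inl j => t j | inr j => u j end); split.
  by move=> k; case: fintype.split.
move=> i e; rewrite Pt Qu /= !sat_ren /=.
set v := (fun k => _) : 'I_(n + m) -> _.
have -> : v \o @lshift n m = fun k => t k i e.
  by apply/funext => k; rewrite /v /= -/(fintype.unsplit (inl k)) unsplitK.
have -> // : v \o @rshift n m = fun k => u k i e.
by apply/funext => k; rewrite /v /= -/(fintype.unsplit (inr k)) unsplitK.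
Qed.

Lemma dfn_all (P : forall i, S i -> (nat -> S i) -> Prop) :
  dfn (fun i e => P i (e 0) (fun j => e j.+1)) ->
  dfn (fun i e => forall x, P i x e).
Proof.
move=> [n [p [t [ht Pt]]]].
(* [push x e] puts the bound value at index 0. The first component of [r k] tells whether argument
   [k] reads this value; the second is the atom read otherwise, with its index lowered by one. *)
have /choice[r hr] : forall k,
    exists r : ('I_n.+1 * (forall i, (nat -> S i) -> S i)),
    atom r.2 /\ forall i x e, t k i (push x e) =
      if r.1 == ord0 then x else r.2 i e.
  move=> k; case: (ht k) => [[[|j] ->]|[c Kc ->]].
  - by exists (ord0, fun i e => e 0); split=> //; apply: atom_var.
  - exists (lift ord0 k, fun i e => e j).
    split; first exact: atom_var.
    by move=> i x e; rewrite eq_sym (negbTE (neq_lift _ _)).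
  - exists (lift ord0 k, fun i e => c i).
    split; first exact: atom_const.
    by move=> i x e; rewrite eq_sym (negbTE (neq_lift _ _)).
(* Several arguments may read the bound variable; [s] identifies them all with [ord0]. *)
pose s k := if (r k).1 == ord0 then ord0 else lift ord0 k : 'I_n.+1.
exists n, (All (ren p s)), (fun k => (r k).2); split=> [k|i e].
  by case: (hr k).
have E x : P i x e <-> sat p (fun k => t k i (push x e)) by rewrite -Pt.
split=> /= H x; move: (H x); rewrite sat_ren E.
all: congr (sat p _); apply/funext => k /=; case: (hr k) => _ ->.
all: by rewrite /s; case: ifP; rewrite ?scons0 ?sconsS.
Qed.

Lemma dfn_not P : dfn P -> dfn (fun i e => ~ P i e).
Proof. by move=> dP; apply: dfn_imp dP dfn_false. Qed.

Lemma dfn_and P Q : dfn P -> dfn Q -> dfn (fun i e => P i e /\ Q i e).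
Proof.
move=> dP dQ; apply: dfn_ext (dfn_not (dfn_imp dP (dfn_not dQ))) _ => i e.
by rewrite not_implyP notK.
Qed.

Lemma dfn_or P Q : dfn P -> dfn Q -> dfn (fun i e => P i e \/ Q i e).
Proof.
move=> dP dQ; apply: dfn_ext (dfn_imp (dfn_not dP) dQ) _ => i e.
by rewrite implyNp.
Qed.

Lemma dfn_ex (P : forall i, S i -> (nat -> S i) -> Prop) :
  dfn (fun i e => P i (e 0) (fun j => e j.+1)) ->
  dfn (fun i e => exists x, P i x e).
Proof.
move=> dP.
have := dfn_not (@dfn_all (fun i x e => ~ P i x e) (dfn_not dP)).
move=> /dfn_ext; apply=> i e; split=> [/existsNP[x]|[x Px] /(_ x)//].
by rewrite notK; exists x.
Qed.

Lemma dfn_eq t u : atom t -> atom u -> dfn (fun i e => t i e = u i e).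
Proof.
move=> ht hu.
have := @dfn_sat 2 (Equal (Var ord0) (Var ord_max))
  (fun k => if k == ord0 then t else u).
by move=> /(_ _)/dfn_ext; apply=> // k; case: ifP.
Qed.

Lemma dfn_sat2 (phi : formula L 2) t u : atom t -> atom u ->
  dfn (fun i e => sat phi (tnth [tuple t i e; u i e])).
Proof.
move=> ht hu.
have := @dfn_sat 2 phi (tnth [tuple t; u]).
move=> /(_ _)/dfn_ext; apply.
  by case=> -[|[|//]] ?.
move=> i e; rewrite (_ : (fun k => _) = tnth [tuple t i e; u i e]) //.
by apply/funext => -[[|[|//]] ?].
Qed.

Lemma dfn_rel2 (R : rsym L 2) t u : atom t -> atom u ->
  dfn (fun i e => slt R (t i e) (u i e)).
Proof.
move=> ht hu; apply: dfn_ext (dfn_sat2 (Rel R (@Var L 2)) ht hu) _ => i e.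
exact: iff_refl.
Qed.

Lemma dfn_forall_ord n (P : 'I_n -> forall i, (nat -> S i) -> Prop) :
  (forall j, dfn (P j)) -> dfn (fun i e => forall j, P j i e).
Proof.
elim: n P => [|n IH] P dP.
  by apply: dfn_ext (dfn_not dfn_false) _ => i e; split=> // _ [].
apply: dfn_ext (dfn_and (dP ord0) (IH (fun j => P (lift ord0 j)) _)) _ => //.
move=> i e; split=> [[P0 PS] j|H]; last by split.
by case: (unliftP ord0 j) => [k ->|->].
Qed.

End Definable.

(* Separates the entries of [w] equal to [x0] from those satisfying [P]; the
   case where [P] is empty needs its own treatment, as no default value exists. *)
Lemma tuple_split (X : Type) (P : set X) (x0 : X) n (w : 'I_n -> X) :
    (forall i, P (w i) \/ w i = x0) ->
  exists m (v : 'I_m -> X) (r : 'I_n -> 'I_m.+1),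
    (forall j, P (v j)) /\ w = scons x0 v \o r.
Proof.
move=> wP; have [[p Pp]|nP] := pselect (exists p, P p); last first.
  exists 0, (tnth [tuple]), (fun=> ord0); split; first by case.
  apply/funext => i /=; rewrite scons0; case: (wP i) => // Pw.
  by case: nP; exists (w i).
exists n, (fun i => if `[< P (w i) >] then w i else p).
exists (fun i => if `[< P (w i) >] then lift ord0 i else ord0); split.
  by move=> j; case: asboolP.
apply/funext => i /=; case: asboolP => Pw; first by rewrite sconsS asboolT.
by rewrite scons0; case: (wP i).
Qed.

(** * Definable sets and closures in one structure *)

Section DefinableSets.
Variables (L : language) (M : structure L).
Implicit Types (A B : set M) (X Y : set M).

Definition defset A X : Prop := exists2 phi, Defs.over A phi & solutions phi = X.

Definition consts A : set (unit -> M) := [set c | A (c tt)].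

Notation dfnM A P := (@dfn L unit (fun=> M) (consts A) P).

Lemma atomM_const A a : A a -> atom (S := fun=> M) (consts A) (fun _ _ => a).
Proof. by move=> Aa; apply: (@atom_const _ _ (fun=> M) _ (fun=> a)). Qed.

Lemma dfn_mem A X (t : unit -> (nat -> M) -> M) : defset A X ->
  atom (S := fun=> M) (consts A) t -> dfnM A (fun i e => X (t i e)).
Proof.
move=> [[n phi p] /= Ap <-] ht.
have := @dfn_sat L _ (fun=> M) (consts A) _ phi
  (scons t (fun j _ _ => p j)).
move=> /(_ _)/dfn_ext; apply.
  move=> k; case: (unliftP ord0 k) => [j ->|->]; rewrite ?sconsS ?scons0 //.
  exact: atomM_const (Ap j).
move=> i e; rewrite /solutions /=.
rewrite (_ : (fun k => _) = scons (t i e) p) //.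
apply/funext => k; case: (unliftP ord0 k) => [j ->|->];
  by rewrite ?sconsS ?scons0.
Qed.

(** Only [e 0] matters, so constant environments suffice: there all variables read the same point,
    and the remaining atoms are constants of [A], which become the parameters. *)
Lemma dfn_defset A X : dfnM A (fun _ e => X (e 0)) -> defset A X.
Proof.
move=> [n [phi [t [ht Xt]]]].
pose isc (u : unit -> (nat -> M) -> M) := exists c, A c /\ u = fun _ _ => c.
pose v0 := fun (_ : unit) (e : nat -> M) => e 0.
have /choice[w hw] : forall k, exists u : unit -> (nat -> M) -> M,
    (isc u \/ u = v0) /\ forall x, t k tt (fun=> x) = u tt (fun=> x).
  move=> k; case: (ht k) => [[j ->]|[c Ac ->]].
    by exists v0; split=> //; right.
  exists (fun _ _ => c tt); split=> //; left; by exists (c tt).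
have [m [v [r [hv wr]]]] := tuple_split (fun k => (hw k).1).
have /choice[p hp] : forall j, exists c, A c /\ v j = fun _ _ => c := hv.
exists (PFormula (ren phi r) p); first by move=> j; case: (hp j).
apply/seteqP; split=> x /=; rewrite /solutions /= sat_ren;
  move: (Xt tt (fun=> x)) => /= ->.
all: congr (sat phi _); apply/funext => k /=.
all: rewrite (hw k).2 wr /=; case: (unliftP ord0 (r k)) => [j ->|->].
all: rewrite ?sconsS ?scons0 //; by case: (hp j) => _ ->.
Qed.

Lemma defsetW A B X : A `<=` B -> defset A X -> defset B X.
Proof. by move=> AB [phi ophi <-]; exists phi => // i; apply: AB. Qed.

Lemma dclP A b : dcl A b <-> defset A [set b].
Proof. by []. Qed.

Lemma aclP A b : acl A b <-> exists X, [/\ defset A X, finite_set X & X b].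
Proof.
split=> [[phi [o f s]]|[X [[phi o <-] f s]]]; last by exists phi.
by exists (solutions phi); split=> //; exists phi.
Qed.

Lemma sub_dcl A : A `<=` dcl A.
Proof.
move=> a Aa; apply: dfn_defset; apply: dfn_eq.
  exact: atom_var.
exact: atomM_const.
Qed.

Lemma dclW A B : A `<=` B -> dcl A `<=` dcl B.
Proof. by move=> AB b; apply: defsetW. Qed.

Lemma defset_sat A n (phi : formula L n.+1) (v : 'I_n -> M) :
  (forall i, A (v i)) -> defset A [set x | sat phi (scons x v)].
Proof. by move=> Av; exists (PFormula phi v). Qed.

End DefinableSets.

Ltac dfn_atom :=
  solve [ apply: atom_var | apply: atomM_const; solve [ assumption | by []
  | by left | by right | by do ?[left|right] ]
  | apply: atom_const; assumption].
Ltac dfn_mem_tac :=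
  apply: dfn_mem; [first [assumption | apply: defsetW; last eassumption;
    by [|left|right|move=> ? ?; left|move=> ? ?; right]] | dfn_atom].
Ltac dfn_tac :=
  cbn beta;
  repeat first
  [ solve [dfn_mem_tac | apply: dfn_rel2; dfn_atom | apply: dfn_eq; dfn_atom]
  | apply: dfn_and | apply: dfn_or | apply: dfn_not | apply: dfn_imp
  | apply: dfn_all | apply: dfn_ex | apply: dfn_false ].

(** * Transfer from an o-minimal structure *)

Lemma finite_set_ind (T : Type) (P : set T -> Prop) : P set0 ->
    (forall a A, finite_set A -> P A -> P (a |` A)) ->
  forall A, finite_set A -> P A.
Proof.
move=> P0 PU A /(@finite_seqP {classic T})[s ->].
elim: s => [|a s IH]; first by rewrite set_nil.
have -> : [set` a :: s] = a |` [set` s].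
  apply/seteqP; split=> x /=; rewrite inE; first by move=> /predU1P.
  by move=> ?; apply/predU1P.
by apply: PU => //; exact: (@finite_seq {classic T}).
Qed.

Lemma finite_minimal (T : Type) (R : T -> T -> Prop) (A : set T) :
    (forall x, ~ R x x) -> (forall x y z, R x y -> R y z -> R x z) ->
    finite_set A -> A !=set0 ->
  exists2 m, A m & forall x, A x -> ~ R x m.
Proof.
move=> irr tr; move: A; apply: finite_set_ind => [[]//|a A _ IH _].
have [->|/set0P/IH[m Am mA]] := eqVneq A set0.
  by exists a => [|x [->|//]]; [left|apply: irr].
have [Ram|nRam] := pselect (R a m).
  exists a => [|x [->|Ax Rxa]]; [by left|exact: irr|].
  exact: mA Ax (tr _ _ _ Rxa Ram).
by exists m => [|x [->//|/mA]]; [right|].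
Qed.

(** * Sentences and transfer *)

Section Sentences.
Variable L : language.

Fixpoint closeall n : formula L n -> sentence L :=
  match n with
  | 0 => id
  | n'.+1 => fun phi => closeall (All phi)
  end.

Lemma holds_closeall (M : structure L) n (phi : formula L n) :
  holds M (closeall phi) <-> forall v : 'I_n -> M, sat phi v.
Proof.
elim: n phi => [|n IH] phi /=.
  by split=> [h v|h]; [rewrite (ord0_fun_eq v (tnth [tuple]))|apply: h].
rewrite IH /=; split=> [h v|h v x]; last exact: h.
by rewrite -(scons_eta v).
Qed.

(** Without constants, [phi] reads finitely many variables, and its universal closure is a sentence.
    One sentence serves the whole family, which is what makes transfer possible. *)
Lemma dfn_sentence (I : Type) (S : I -> structure L)
    (P : forall i, (nat -> S i) -> Prop) : dfn set0 P ->
  exists sigma : sentence L, forall i, holds (S i) sigma <-> forall e, P i e.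
Proof.
move=> [n [phi [t [ht Pt]]]].
have /choice[j tj] : forall k, exists j, t k = fun i e => e j.
  by move=> k; case: (ht k) => // -[].
pose m := \max_k j k.
have jm k : j k < m.+1 by rewrite ltnS; apply: (@leq_bigmax _ j).
exists (closeall (ren phi (fun k => inord (j k) : 'I_m.+1))) => i.
rewrite holds_closeall; split=> [H e|H v].
  rewrite Pt; move: (H (fun k => e k)); rewrite sat_ren.
  by congr (sat phi _); apply/funext => k /=; rewrite tj inordK.
rewrite sat_ren; move: (H (fun k => v (inord k))); rewrite Pt.
by congr (sat phi _); apply/funext => k /=; rewrite tj.
Qed.

Lemma transfer (M N : structure L)
    (P : forall b : bool, (nat -> if b then N else M) -> Prop) :
    theory_of N `<=` theory_of M ->
    @dfn L bool (fun b => if b then N else M) set0 P ->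
  (forall e, P true e) -> forall e, P false e.
Proof.
move=> NM /dfn_sentence[sigma hs] Pt.
by apply/(hs false)/NM/(hs true).
Qed.

Lemma model_complete (M N : structure L) :
  is_model M (theory_of N) -> theory_of M = theory_of N.
Proof.
move=> MN; apply/seteqP; split=> // phi Mphi; apply: contrapT => nN.
by have /= := MN (Neg phi) nN; apply.
Qed.

End Sentences.

(** * The left end of a definable set *)

Section Order.
Variables (L : language) (lt : rsym L 2).

(** The trace of o-minimality that transfers: unlike the number of intervals, it is one sentence for
    each formula. A set has a least element, or begins with an open interval at its infimum [e], or
    contains a ray unbounded to the left; [c] makes the ray nonempty. *)
Definition least_or_ray (M : structure L) (X : set M) : Prop :=
  (exists x, X x) ->
  (exists m, X m /\ forall x, X x -> ~ slt lt x m) \/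
  (exists e, exists d, slt lt e d /\
     ((forall x, slt lt e x -> slt lt x d -> X x) /\
      forall x, X x -> ~ slt lt x e)) \/
  (exists c, exists d, slt lt c d /\ forall x, slt lt x d -> X x).

Section InOMinimal.
Variable N : structure L.
Hypotheses (dloN : dense_linear_order lt N).
Hypothesis N2 : forall x : N, exists y, y <> x.

Lemma least_or_ray_piece I : interval_or_point lt I -> least_or_ray (I : set N).
Proof.
have [irr tr tot _] := dloN.
case=> [[a [b ->]]|[a ->]] [x]; last first.
  by move=> _; left; exists a; split=> // y ->; apply: irr.
rewrite /open_interval /=; case: a b => [a|] [b|] [ax xb].
- right; left; exists a, b; split; first exact: tr xb.
  by split=> // y [ay _] ya; apply: irr (tr _ _ _ ay ya).
- right; left; exists a, x; split=> //.
  by split=> // y [ay _] ya; apply: irr (tr _ _ _ ay ya).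
- by right; right; exists x, b.
(* The piece is the whole line; a second point is needed to bound a nonempty ray. *)
- right; right; have [y yx] := N2 x.
  by case: (tot x y) => // ?; [exists x, y|case: yx|exists y, x].
Qed.

(** The union begins like the piece that reaches further to the left; at equal ends, a least element
    wins over an open end. *)
Lemma least_or_rayU (X Y : set N) :
  least_or_ray X -> least_or_ray Y -> least_or_ray (X `|` Y).
Proof.
have [irr tr tot _] := dloN.
have asym (x y : N) : slt lt x y -> ~ slt lt y x by move=> xy /(tr _ _ _ xy)/irr.
have tr' (x y z : N) : ~ slt lt y x -> slt lt y z -> slt lt x z.
  by move=> yx yz; case: (tot x y) => [xy||//]; [exact: tr xy yz|move=> ->].
have tr2 (x y z : N) : ~ slt lt y x -> ~ slt lt z y -> ~ slt lt z x.
  by move=> yx zy zx; apply: yx; apply: tr' zy zx.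
move=> QX QY; have [X0|nX0] := pselect (exists x, X x); last first.
  have -> // : X `|` Y = Y.
  by apply/seteqP; split=> x; [case=> // Xx; case: nX0; exists x|right].
have [Y0|nY0] := pselect (exists x, Y x); last first.
  have -> // : X `|` Y = X.
  by apply/seteqP; split=> x; [case=> // Yx; case: nY0; exists x|left].
move=> _; case: (QX X0) => [[m [Xm mX]]|[[e [d [ed [edX eX]]]]|]]; last first.
- by move=> [c [d [cd dX]]]; right; right; exists c, d; split=> // x /dX; left.
- case: (QY Y0) => [[m [Ym mY]]|[[e' [d' [ed' [edY eY]]]]|]]; last first.
  + by move=> [c [d0 [cd dX]]]; right; right; exists c, d0; split=> // x /dX; right.
  + have [ee'|ee'] := pselect (slt lt e' e).
      right; left; exists e', d'; split=> //; split=> [x ex xd|x].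
        by right; apply: edY.
      by case=> [/eX|/eY //]; apply: tr2; apply: asym.
    right; left; exists e, d; split=> //; split=> [x ex xd|x].
      by left; apply: edX.
    by case=> [/eX//|/eY]; apply: tr2.
  + have [em|em] := pselect (slt lt e m).
      right; left; exists e, d; split=> //; split=> [x ex xd|x].
        by left; apply: edX.
      by case=> [/eX//|/mY]; apply: tr2; apply: asym.
    left; exists m; split; first by right.
    by move=> x [/eX|/mY//]; apply: tr2.
- case: (QY Y0) => [[m' [Ym mY]]|[[e' [d' [ed' [edY eY]]]]|]]; last first.
  + by move=> [c [d0 [cd dX]]]; right; right; exists c, d0; split=> // x /dX; right.
  + have [em|em] := pselect (slt lt e' m).
      right; left; exists e', d'; split=> //; split=> [x ex xd|x].
        by right; apply: edY.
      by case=> [/mX|/eY//]; apply: tr2; apply: asym.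
    left; exists m; split; first by left.
    by move=> x [/mX//|/eY]; apply: tr2.
  + have [em|em] := pselect (slt lt m' m).
      left; exists m'; split; first by right.
      by move=> x [/mX|/mY//]; apply: tr2; apply: asym.
    left; exists m; split; first by left.
    by move=> x [/mX//|/mY]; apply: tr2.
Qed.

Lemma o_minimal_least_or_ray A (X : set N) :
  o_minimal lt N -> defset A X -> least_or_ray X.
Proof.
move=> omin [phi _ <-]; have [F [finF sF ->]] := omin phi.
move: F finF sF; apply: finite_set_ind => [_|I F _ IH IF].
  by rewrite bigcup_set0 => -[].
rewrite bigcup_setU bigcup_set1; apply: least_or_rayU.
  by apply: least_or_ray_piece; apply: IF; left.
by apply: IH => J FJ; apply: IF; right.
Qed.

End InOMinimal.

Section Transfer.
Variables M N : structure L.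
Hypotheses (dloN : dense_linear_order lt N) (ominN : o_minimal lt N).
Hypothesis (NM : theory_of M = theory_of N).
Hypothesis (M2 : exists x y : M, y <> x).

Let S (b : bool) : structure L := if b then N else M.

Let sub_NM : theory_of N `<=` theory_of M. Proof. by rewrite NM. Qed.

Lemma transfer_dlo : dense_linear_order lt M.
Proof.
have [irr tr tot dns] := dloN.
have irrM := @transfer L M N (fun b e => ~ slt lt (e 0) (e 0)) sub_NM
  ltac:(dfn_tac) (fun e => irr _).
have trM := @transfer L M N
  (fun b e => slt lt (e 0) (e 1) -> slt lt (e 1) (e 2) -> slt lt (e 0) (e 2))
  sub_NM ltac:(dfn_tac) (fun e => tr _ _ _).
have totM := @transfer L M N
  (fun b e => slt lt (e 0) (e 1) \/ e 0 = e 1 \/ slt lt (e 1) (e 0))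
  sub_NM ltac:(dfn_tac) (fun e => match tot (e 0) (e 1) with
    Or31 h => or_introl h | Or32 h => or_intror (or_introl h)
  | Or33 h => or_intror (or_intror h) end).
have dnsM := @transfer L M N
  (fun b e => slt lt (e 0) (e 1) -> exists z, slt lt (e 0) z /\ slt lt z (e 1))
  sub_NM ltac:(dfn_tac) (fun e => dns _ _).
split=> [x|x y z|x y|x y].
- exact: irrM (fun=> x).
- exact: trM (nth x [:: x; y; z]).
- case: (totM (nth x [:: x; y])) => [|[|]] ?;
    [constructor 1|constructor 2|constructor 3] => //.
- exact: dnsM (nth x [:: x; y]).
Qed.

Lemma transfer_two (x : N) : exists y, y <> x.
Proof.
have NM' : theory_of M `<=` theory_of N by rewrite NM.
have H := @transfer L N M (fun b e => exists y, y <> e 0) NM' ltac:(dfn_tac).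
apply: (H _ (fun=> x)) => e; have [y [z yz]] := M2.
by have [zx|] := pselect (z = e 0); [exists y; rewrite -zx; apply/nesym|exists z].
Qed.

Lemma transfer_least_or_ray A (X : set M) : defset A X -> least_or_ray X.
Proof.
move=> [[n phi v] _ <-]; rewrite /solutions /=.
have [a _] : exists a : M, True by case: (carrier_inhabited M) => a; exists a.
(* The parameters become the first [n] entries of an environment, so that the transferred sentence
   quantifies over them; [a] fills the other entries. *)
pose e (i : nat) := if insub i is Some k then v k else a.
have := @transfer L M N (fun b e =>
  least_or_ray [set x | sat phi (scons x (fun k : 'I_n => e k))]) sub_NM.
move=> /(_ _ _ e).
rewrite (_ : (fun k : 'I_n => e k) = v); last first.
  by apply/funext => k; rewrite /e valK.
apply.
(* The quantifiers of [least_or_ray] shift the parameters by varying amounts, hence the arbitrary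
   [g]. *)
- have dphi j (g : 'I_n -> nat) : @dfn L bool S set0 (fun b e =>
      sat phi (scons (e j) (fun k : 'I_n => e (g k)))).
    have := @dfn_sat L bool S set0 _ phi
      (fun k => scons (fun _ e => e j) (fun (k : 'I_n) _ e => e (g k)) k).
    move=> /(_ _)/dfn_ext; apply.
      move=> k; case: (unliftP ord0 k) => [i ->|->]; rewrite ?sconsS ?scons0;
      exact: atom_var.
    move=> b e'; set w := (fun k => _).
    rewrite (_ : w = scons (e' j) (fun k : 'I_n => e' (g k))) //.
    apply/funext => k; rewrite /w; case: (unliftP ord0 k) => [i ->|->];
    by rewrite ?sconsS ?scons0.
  rewrite /least_or_ray /=; dfn_tac; exact: dphi.
- move=> {}e; apply: o_minimal_least_or_ray => //; first exact: transfer_two.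
  exact: (@defset_sat _ _ setT).
Qed.

End Transfer.
End Order.

(** * Types and small sets *)

Section Types.
Variables (L : language) (M : structure L).
Implicit Types (A : set M) (B : set (set M)).

Definition directed_base B : Prop :=
  [/\ B !=set0, forall X, B X -> X !=set0 &
      forall X Y, B X -> B Y -> exists2 Z, B Z & Z `<=` X `&` Y].

(** The filter generated by [B] extends to an ultrafilter; the formulas over [A] whose solution sets
    belong to it form a complete type. *)
Lemma type_of_base A B : directed_base B ->
  exists2 q, is_type A q &
    forall phi X, Defs.over A phi -> B X -> X `<=` solutions phi -> q phi.
Proof.
move=> [B0 Bne Bdir].
have fF : Filter (filter_from B id) by exact: filter_from_filter.
have pF : ProperFilter (filter_from B id) by exact: filter_from_proper.
have [U [UU sU]] := ultraFilterLemma pF.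
exists [set phi | Defs.over A phi /\ U (solutions phi)]; last first.
  by move=> phi X op BX Xp; split=> //; apply: sU; exists X.
split=> [phi []//| |phi op].
- move=> F finF sF; suff : U [set x | realizes F x] by exact: filter_ex.
  move: F finF sF; apply: finite_set_ind => [_|phi F _ IH sF].
    by apply: filterS filterT => x _ phi [].
  have [_ Uphi] : Defs.over A phi /\ U (solutions phi) by apply: sF; left.
  have UF : U [set x | realizes F x] by apply: IH => psi Fpsi; apply: sF; right.
  apply: filterS (filterI Uphi UF) => x [px Fx] psi [->//|]; exact: Fx.
- have [|] := in_ultra_setVsetC (solutions phi) UU; first by left.
  by right.
Qed.

Lemma type_not_both A q phi : is_type A q -> q phi -> ~ q (pf_neg phi).
Proof.
move=> [_ fin _] qp qn.
have [||x xr] := fin [set phi; pf_neg phi]; first exact: finite_set2.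
  by move=> psi [->|->].
exact: (xr (pf_neg phi) (or_intror erefl)) (xr phi (or_introl erefl)).
Qed.

(** The base consists of the cofinite subsets of [X], which excludes every finite solution set. *)
Lemma nonalgebraic_type A X : infinite_set X ->
  exists q, [/\ is_type A q, ~ algebraic_type q &
    forall phi, Defs.over A phi -> X `<=` solutions phi -> q phi].
Proof.
move=> infX.
pose B := [set X `\` F | F in [set F | finite_set F]].
have [|q tq Bq] := @type_of_base A B.
  split.
  - by exists (X `\` set0), set0 => //; apply: finite_set0.
  - by move=> _ [F finF <-]; apply/infinite_setN0/infinite_setD.
  - move=> _ _ [F finF <-] [G finG <-]; exists (X `\` (F `|` G)).
      by exists (F `|` G) => //; rewrite /= finite_setU.
    by move=> x [Xx nFG]; split; split=> // ?; apply: nFG; [left|right].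
exists q; split=> //.
- move=> [phi qphi fphi]; apply: (type_not_both tq qphi).
  have [sq _ _] := tq; apply: (Bq _ (X `\` solutions phi)); first exact: (sq phi).
    by exists (solutions phi).
  by move=> x [].
- move=> phi op Xp; apply: Bq (X `\` set0) op _ _.
    by exists set0 => //; apply: finite_set0.
  by rewrite setD0.
Qed.

(** Saturation speaks of complete types; [type_of_base] completes the partial type given by [B]. *)
Lemma saturated_directed A B : saturated M -> card_lt A [set: M] ->
  directed_base B -> B `<=` defset A -> exists x, forall X, B X -> X x.
Proof.
move=> satM smallA dirB Bdef; have [q tq Bq] := type_of_base A dirB.
have [x xq] := satM A smallA q tq; exists x => X BX.
have [phi op sphi] := Bdef X BX.
by rewrite -sphi; apply: xq; apply: Bq BX _ => //; rewrite sphi.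
Qed.

End Types.

(** * Small subsets of the monster model *)

Section Small.
Variables (M lambda : Type).
Hypothesis inacc : strongly_inaccessible lambda.
Hypothesis Mlambda : [set: M] #= [set: lambda].
Implicit Types A : set M.

Definition small A : Prop := card_lt A [set: M].

Lemma monster_infinite : infinite_set [set: M].
Proof.
have [unc _ _] := inacc; move=> fin; apply: unc; apply: finite_set_countable.
by rewrite -(eq_finite_set Mlambda).
Qed.

Lemma small_finite A : finite_set A -> small A.
Proof. by move=> finA /card_le_finite/(_ finA)/monster_infinite. Qed.

(** Regularity is stated for subsets of [lambda] and is carried to [M] along a bijection. *)
Lemma small_bigcup (I : set M) (F : M -> set M) :
  small I -> (forall i, I i -> small (F i)) -> small (\bigcup_(i in I) F i).
Proof.
have [_ _ reg] := inacc; move=> smI smF.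
have [f [h fK hK]] : exists f : M -> lambda, bijective f.
  have /card_bijP[f [h fK hK]] := Mlambda.
  exists (fun x => \val (f (to_setT x))).
  exists (fun y => \val (h (to_setT y))) => x.
    have -> : to_setT (\val (f (to_setT x))) = f (to_setT x) by exact: val_inj.
    by rewrite fK.
  have -> : to_setT (\val (h (to_setT x))) = h (to_setT x) by exact: val_inj.
  by rewrite hK.
have lt_image A : small A -> card_lt (f @` A) [set: lambda].
  move=> smA le; apply: smA; apply: card_le_trans (card_image_le f A).
  by rewrite (card_le_eql Mlambda).
have := reg (f @` I) (fun y => f @` F (h y)) (lt_image _ smI).
have smF' y : (f @` I) y -> card_lt (f @` F (h y)) [set: lambda].
  by move=> [x Ix <-]; rewrite fK; apply/lt_image/smF.
move=> /(_ smF') nle le; apply: nle.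
rewrite -(card_le_eql Mlambda); apply: card_le_trans le _.
apply: card_le_trans (card_image_le h _); apply: subset_card_le.
move=> x [i Ii Fx]; exists (f x); last exact: fK.
exists (f i); first by exists i.
by rewrite fK; exists x.
Qed.

Lemma smallU A A' : small A -> small A' -> small (A `|` A').
Proof.
move=> smA smA'; have /infinite_setN0[x _] := monster_infinite.
have /infinite_setN0[y [_ yx]] :
    infinite_set ([set: M] `\` [set x]).
  by apply: infinite_setD; [exact: monster_infinite|exact: finite_set1].
pose F z := if `[< z = x >] then A else A'.
have -> : A `|` A' = \bigcup_(z in [set x; y]) F z.
  apply/seteqP; split=> [z [Az|Az]|z [t _]]; rewrite /F.
  - by exists x; [left|rewrite /F asboolT].
  - by exists y; [right|rewrite /F asboolF].
  - by case: asboolP; [left|right].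
apply: small_bigcup => [|z _]; first exact/small_finite/finite_set2.
by rewrite /F; case: asboolP.
Qed.

End Small.

(** * Consequences of T^indep *)

Section Expansion.
Variable L : language.

Fixpoint expand_term n (t : term L n) : term (expand L) n :=
  match t with
  | Var i => Var i
  | App m s a => @App (expand L) n m s (fun i => expand_term (a i))
  end.

Fixpoint expand_formula n (phi : formula L n) : formula (expand L) n :=
  match phi with
  | Bot n => Bot n
  | Equal _ t u => Equal (expand_term t) (expand_term u)
  | Rel n m r a => @Rel (expand L) n m (OldRel r) (fun i => expand_term (a i))
  | Imp _ p q => Imp (expand_formula p) (expand_formula q)
  | All _ p => All (expand_formula p)
  end.

Lemma eval_expand (M : structure L) (D : set M) n (t : term L n) (v : 'I_n -> M) :
  @eval _ (expansion D) n v (expand_term t) = eval v t.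
Proof. by elim: t => //= m s a IH; congr (fint M s _); apply/funext. Qed.

Lemma sat_expand (M : structure L) (D : set M) n (phi : formula L n)
    (v : 'I_n -> M) :
  @sat _ (expansion D) n (expand_formula phi) v <-> sat phi v.
Proof.
elim: phi v => {n} [n|n t u|n m r a|n p IHp q IHq|n p IHp] v //=.
- by rewrite !eval_expand.
- rewrite (_ : (fun i => _) = (fun i => eval v (a i))) //.
  by apply/funext => i; rewrite eval_expand.
- by rewrite IHp IHq.
- by split=> H x; apply/IHp.
Qed.

(** All structures with a predicate form a single family, so that one sentence can be checked in
    every H-structure and then read in the given pair. *)
Definition pair_structure := {N : structure L & set N}.
Definition pair_expansion (p : pair_structure) : structure (expand L) :=
  expansion (projT2 p).

Notation pair N K := (existT (fun N : structure L => set N) N K).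

Lemma dfn_pred t : atom (S := pair_expansion) set0 t ->
  @dfn _ _ pair_expansion set0 (fun p e => projT2 p (t p e)).
Proof.
move=> ht.
have := @dfn_sat _ _ pair_expansion set0 1
  (@Rel (expand L) 1 1 (NewPred L) (fun _ => Var ord0)) (fun _ => t).
by move=> /(_ _)/dfn_ext; apply.
Qed.

Lemma dfn_expand n (phi : formula L n)
    (t : 'I_n -> forall p, (nat -> pair_expansion p) -> pair_expansion p) :
  (forall i, atom set0 (t i)) ->
  @dfn _ _ pair_expansion set0
    (fun p e => @sat L (projT1 p) n phi (fun i => t i p e)).
Proof.
move=> ht; apply: dfn_ext (dfn_sat (expand_formula phi) ht) _ => p e.
exact: sat_expand.
Qed.

Lemma dfn_expand2 (phi : formula L 2) t u :
  atom (S := pair_expansion) set0 t -> atom (S := pair_expansion) set0 u ->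
  @dfn _ _ pair_expansion set0
    (fun p e => @sat L (projT1 p) 2 phi (tnth [tuple t p e; u p e])).
Proof.
move=> ht hu; apply: dfn_ext (dfn_sat2 (expand_formula phi) ht hu) _ => p e.
exact: sat_expand.
Qed.

Lemma dfn_lt (lt : rsym L 2) t u :
  atom (S := pair_expansion) set0 t -> atom (S := pair_expansion) set0 u ->
  @dfn _ _ pair_expansion set0
    (fun p e => @slt L lt (projT1 p) (t p e) (u p e)).
Proof.
move=> ht hu; apply: dfn_ext (dfn_expand2 (Rel lt (@Var L 2)) ht hu) _ => p e.
exact: iff_refl.
Qed.

Lemma T_indep_transfer T (M : structure L) (D : set M)
    (P : forall p : pair_structure, (nat -> projT1 p) -> Prop) :
    T_indep T `<=` theory_of (expansion D) ->
    @dfn (expand L) pair_structure pair_expansion set0 P ->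
    (forall (N : structure L) (K : set N), is_H_structure T K ->
      forall e, P (pair N K) e) ->
  forall e, P (pair M D) e.
Proof.
move=> TD /dfn_sentence[sigma hs] PH.
by apply/(hs (pair M D))/TD => N K HK; apply/(hs (pair N K))/PH.
Qed.

End Expansion.

(** * First-order properties of the predicate *)

Section HStructures.
Variables (L : language) (lt : rsym L 2) (N0 M : structure L).
Hypothesis dlo0 : dense_linear_order lt N0.
Hypothesis MN0 : theory_of M = theory_of N0.
Variables (k : nat) (f : 'I_k -> M -> M).
Hypothesis f_definable : forall i, definable0_fun (f i).

(** These are the properties of [D] on which the back-and-forth rests: two consequences of
    independence, then Density and Extension restricted to intervals, with dcl(D) represented by the
    images under the [f i]. *)
Definition H_properties (D : set M) : Prop :=
  [/\ forall x, D x -> ~ dcl set0 x,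
      forall i x, D x -> D (f i x) -> f i x = x,
      forall c d, slt lt c d -> exists x, [/\ D x, slt lt c x & slt lt x d] &
      forall c d, slt lt c d -> exists x, [/\ slt lt c x, slt lt x d &
        forall i y, D y -> x <> f i y]].

Lemma interval_infinite (N : structure L) (c d : N) : dense_linear_order lt N ->
  slt lt c d -> infinite_set [set x | slt lt c x /\ slt lt x d].
Proof.
move=> [irr tr _ dns] cd fin.
have [x cxd] := dns _ _ cd.
have [|m [cm md] mmin] := finite_minimal irr tr fin; first by exists x.
have [y [cy ym]] := dns _ _ cm.
by apply: (mmin y) => //; split=> //; apply: tr md.
Qed.

(** Density and Extension speak of types, so an interval is turned into a non-algebraic type over
    its endpoints. *)
Lemma interval_type (N : structure L) (c d : N) : dense_linear_order lt N ->
    slt lt c d ->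
  exists q, [/\ is_type [set c; d] q, ~ algebraic_type q &
    forall x, realizes q x -> slt lt c x /\ slt lt x d].
Proof.
move=> dloN cd.
have [q [tq nq qX]] := nonalgebraic_type [set c; d] (interval_infinite dloN cd).
exists q; split=> // x qx.
have [phi op sphi] : defset [set c; d] [set x | slt lt c x /\ slt lt x d].
  by apply: dfn_defset; dfn_tac.
have : solutions phi x by apply/qx/qX => //; rewrite sphi.
by rewrite sphi.
Qed.

Lemma H_structure_theory (N : structure L) (K : set N) :
  is_H_structure (theory_of N0) K -> theory_of N = theory_of M.
Proof. by move=> [NN0 _ _ _]; rewrite MN0; apply: model_complete. Qed.

Lemma H_structure_dlo (N : structure L) (K : set N) :
  is_H_structure (theory_of N0) K -> dense_linear_order lt N.
Proof.
move=> /H_structure_theory NM; apply: (transfer_dlo dlo0).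
by rewrite NM.
Qed.

(** The function [f i] lives on [M]; in another H-structure only its formula is available, and it
    still defines a partial function there. *)
Lemma graph_unique (N : structure L) (phi : formula L 2) i :
    theory_of N = theory_of M ->
    (forall x y : M, sat phi (tnth [tuple x; y]) <-> y = f i x) ->
  forall x y y' : N, sat phi (tnth [tuple x; y]) ->
    sat phi (tnth [tuple x; y']) -> y = y'.
Proof.
move=> NM phiP x y y'.
have MN : theory_of M `<=` theory_of N by rewrite NM.
have dphi : @dfn L bool (fun b => if b then M else N) set0 (fun b e =>
    sat phi (tnth [tuple e 0; e 1]) -> sat phi (tnth [tuple e 0; e 2]) ->
    e 1 = e 2).
  by dfn_tac; apply: dfn_sat2; dfn_atom.
apply: (transfer MN dphi _ (nth x [:: x; y; y'])) => e.
by move=> /phiP -> /phiP ->.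
Qed.

Lemma dcl0_formula (N : structure L) (x : N) : dcl set0 x ->
  exists phi : formula L 1, [set y | sat phi (fun=> y)] = [set x].
Proof.
move=> [[n phi v] /= ov <-]; case: n phi v ov => [|n] phi v ov; last first.
  by case: (ov ord0).
by exists phi; apply/seteqP; split=> y; rewrite /solutions /= scons1E.
Qed.

Ltac pair_tac :=
  cbn beta;
  repeat first
  [ solve [apply: dfn_pred; dfn_atom | apply: dfn_lt; dfn_atom
  | apply: dfn_eq; dfn_atom | apply: dfn_expand2; dfn_atom
  | apply: dfn_expand => ?; dfn_atom]
  | apply: dfn_and | apply: dfn_or | apply: dfn_not | apply: dfn_imp
  | apply: dfn_forall_ord => ? | apply: dfn_all | apply: dfn_ex ].

Lemma T_indep_properties (D : set M) :
  T_indep (theory_of N0) `<=` theory_of (expansion D) -> H_properties D.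
Proof.
move=> TD; split.
- move=> x Dx /dcl0_formula[phi phix].
  (* Missing dcl(empty) amounts to one sentence for each [phi]: a point of the predicate is never
     the only solution. *)
  have dP : @dfn (expand L) _ (@pair_expansion L) set0 (fun p e =>
      projT2 p (e 0) -> @sat L (projT1 p) 1 phi (fun=> e 0) ->
      exists y, y <> e 0 /\ @sat L (projT1 p) 1 phi (fun=> y)).
    by pair_tac.
  have [N K HK e Ke pe||y [yx]] := T_indep_transfer TD dP _ (fun=> x) Dx.
  + apply: contrapT => npe; have [_ ind _ _] := HK; apply: (ind _ Ke).
    apply/aclP; exists [set e 0]; split; [|exact: finite_set1|by []].
    rewrite [X in defset _ X](_ : _ = [set y | sat phi (scons y (tnth [tuple]))]).
      by apply: defset_sat => -[].
    apply/seteqP; split=> [_ ->|y]; first by rewrite /= scons1E.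
    rewrite /= scons1E => py; apply: contrapT => ye; apply: npe.
    by exists y.
  + by have : [set x] x by []; rewrite -phix.
  + have -> : sat phi (fun=> y) = [set y | sat phi (fun=> y)] y by [].
    by rewrite phix.
- move=> i x Dx Dfx; have [phi phiP] := f_definable i.
  have dP : @dfn (expand L) _ (@pair_expansion L) set0 (fun p e =>
      projT2 p (e 0) -> projT2 p (e 1) ->
      @sat L (projT1 p) 2 phi (tnth [tuple e 0; e 1]) -> e 1 = e 0).
    by pair_tac.
  apply: (T_indep_transfer TD dP _ (nth x [:: x; f i x])) => //=; last first.
    exact/phiP.
  (* A value of [phi] in [K] different from its argument in [K] would be algebraic over that
     argument, against independence. *)
  move=> N K HK e K0 K1 pe; apply: contrapT => ne.
  have uniq := graph_unique (H_structure_theory HK) phiP.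
  have [_ ind _ _] := HK; apply: (ind _ K1); apply/aclP.
  exists [set y | sat phi (tnth [tuple e 0; y])]; split=> //.
    apply: dfn_defset; apply: dfn_sat2; last exact: atom_var.
    apply: atomM_const; split=> // h; exact/ne/esym.
  apply: (sub_finite_set _ (finite_set1 (e 1))) => y /= py.
  exact: uniq py pe.
- move=> c d cd.
  have dP : @dfn (expand L) _ (@pair_expansion L) set0 (fun p e =>
      @slt L lt (projT1 p) (e 0) (e 1) -> exists x,
      projT2 p x /\ (@slt L lt (projT1 p) (e 0) x /\ @slt L lt (projT1 p) x (e 1))).
    by pair_tac.
  have [|x [Dx [cx xd]]] :=
    T_indep_transfer TD dP _ (nth c [:: c; d]) cd; last first.
    by exists x.
  move=> N K HK e e01.
  have [q [tq nq qe]] := interval_type (H_structure_dlo HK) e01.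
  have [_ _ dens _] := HK.
  have [|a Ka /qe ea] := dens _ _ _ tq nq; first exact: finite_set2.
  by exists a.
- move=> c d cd.
  have /choice[phi phiP] := f_definable.
  have dP : @dfn (expand L) _ (@pair_expansion L) set0 (fun p e =>
      @slt L lt (projT1 p) (e 0) (e 1) -> exists x,
      (@slt L lt (projT1 p) (e 0) x /\ @slt L lt (projT1 p) x (e 1)) /\
      forall i y, projT2 p y -> ~ @sat L (projT1 p) 2 (phi i) (tnth [tuple y; x])).
    by pair_tac.
  have [|x [[cx xd] nx]] :=
    T_indep_transfer TD dP _ (nth c [:: c; d]) cd; last first.
    by exists x; split=> // i y Dy /phiP; apply: nx.
  move=> N K HK e e01.
  have [q [tq nq qe]] := interval_type (H_structure_dlo HK) e01.
  have [_ _ _ ext] := HK.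
  have [|a na /qe ea] := ext _ _ _ tq nq; first exact: finite_set2.
  exists a; split=> // i y Ky pa; apply: na; apply/aclP.
  exists [set z | sat (phi i) (tnth [tuple y; z])]; split=> //.
    apply: dfn_defset; apply: dfn_sat2; last exact: atom_var.
    by apply: atomM_const; right.
  apply: (sub_finite_set _ (finite_set1 a)) => z /= pz.
  exact: (graph_unique (H_structure_theory HK) (phiP i)) pz pa.
Qed.

End HStructures.

(** * Partial elementary maps *)

Section Elementary.
Variables (L : language) (M : structure L).
Implicit Types (G : set (M * M)) (a b : M).

(** Partial maps are coded by their graphs, so that the back step is the forth step for [graph_inv];
    [elem] forces the graph to be functional and injective. *)
Definition elem G : Prop := forall n (phi : formula L n) (v : 'I_n -> M * M),
  (forall i, G (v i)) -> sat phi (fst \o v) <-> sat phi (snd \o v).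

Definition graph_dom G : set M := fst @` G.
Definition graph_ran G : set M := snd @` G.
Definition graph_inv G : set (M * M) := [set p | G (p.2, p.1)].

Lemma graph_domU G a b : graph_dom (G `|` [set (a, b)]) = graph_dom G `|` [set a].
Proof. by rewrite /graph_dom image_setU image_set1. Qed.

Lemma graph_ranU G a b : graph_ran (G `|` [set (a, b)]) = graph_ran G `|` [set b].
Proof. by rewrite /graph_ran image_setU image_set1. Qed.

Lemma graph_dom_inv G : graph_dom (graph_inv G) = graph_ran G.
Proof. by apply/seteqP; split=> _ [[x y] Gxy <-] /=; exists (y, x). Qed.

Lemma graph_ran_inv G : graph_ran (graph_inv G) = graph_dom G.
Proof. by apply/seteqP; split=> _ [[x y] Gxy <-] /=; exists (y, x). Qed.

Lemma graph_invU G a b :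
  graph_inv (G `|` [set (a, b)]) = graph_inv G `|` [set (b, a)].
Proof.
by apply/seteqP; split=> -[x y] /= [Gyx|[-> ->]]; [left|right|left|right].
Qed.

Lemma graph_invK G : graph_inv (graph_inv G) = G.
Proof. by apply/seteqP; split=> -[]. Qed.

Lemma elem_sub G G' : G `<=` G' -> elem G' -> elem G.
Proof. by move=> GG' eG' n phi v Gv; apply: eG' => i; apply: GG'. Qed.

Lemma elem_inv G : elem G -> elem (graph_inv G).
Proof.
move=> eG n phi v Gv; apply: iff_sym.
exact: (eG n phi (fun i => ((v i).2, (v i).1))).
Qed.

Lemma elem_set0 : elem set0.
Proof.
move=> [|n] phi v Gv; last by case: (Gv ord0).
by rewrite (ord0_fun_eq (fst \o v) (snd \o v)).
Qed.

Lemma elemU_sat G a b n (phi : formula L n.+1) (v : 'I_n -> M * M) :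
    elem (G `|` [set (a, b)]) -> (forall i, G (v i)) ->
  sat phi (scons a (fst \o v)) <-> sat phi (scons b (snd \o v)).
Proof.
move=> eG Gv; have := eG _ phi (scons (a, b) v); rewrite !comp_scons; apply.
by move=> i; case: (unliftP ord0 i) => [j ->|->];
  [left; rewrite sconsS; apply: Gv|right; rewrite scons0].
Qed.

(** Repeated occurrences of [(a, b)] are merged into one variable, and one implication suffices
    because it also applies to the negated formula. *)
Lemma elemU G a b :
    (forall n (phi : formula L n.+1) (v : 'I_n -> M * M), (forall i, G (v i)) ->
      sat phi (scons a (fst \o v)) -> sat phi (scons b (snd \o v))) ->
  elem (G `|` [set (a, b)]).
Proof.
move=> H n phi w /(@tuple_split _ G (a, b))[m [v [r [Gv ->]]]].
have step psi := H m psi v Gv.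
have E (g : M * M -> M) :
    g \o (scons (a, b) v \o r) = scons (g (a, b)) (g \o v) \o r.
  by rewrite -comp_scons.
rewrite !E -!sat_ren.
split; first exact: step.
by move=> hb; apply: contrapT => na; apply: (step (Neg (ren phi r))) na hb.
Qed.

Lemma elem_pair G (phi : formula L 2) a b a' b' : elem G -> G (a, b) ->
  G (a', b') -> sat phi (tnth [tuple a; a']) -> sat phi (tnth [tuple b; b']).
Proof.
move=> eG Gab Gab'.
have := eG _ phi (tnth [tuple (a, b); (a', b')]).
have -> : fst \o tnth [tuple (a, b); (a', b')] = tnth [tuple a; a'].
  by apply/funext => -[[|[|//]] ?].
have -> : snd \o tnth [tuple (a, b); (a', b')] = tnth [tuple b; b'].
  by apply/funext => -[[|[|//]] ?].
by move=> H; apply H => -[[|[|//]] ?].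
Qed.

Lemma elem_inj G a b b' : elem G -> G (a, b) -> G (a, b') -> b = b'.
Proof.
move=> eG Gb Gb'.
exact: (@elem_pair G (Equal (Var ord0) (Var ord_max)) a b a b').
Qed.

Lemma dcl_graph_dom G a : dcl (graph_dom G) a ->
  exists n (phi : formula L n.+1) (v : 'I_n -> M * M),
    (forall i, G (v i)) /\ [set x | sat phi (scons x (fst \o v))] = [set a].
Proof.
move=> [[n phi p] /= op <-].
have /choice[v vP] : forall i, exists q, G q /\ q.1 = p i.
  by move=> i; have [q Gq qi] := op i; exists q; split.
exists n, phi, v; split=> [i|]; first by case: (vP i).
rewrite (_ : fst \o v = p) //.
by apply/funext => i; case: (vP i).
Qed.

Lemma elem_dcl_ran G a b : elem (G `|` [set (a, b)]) ->
  dcl (graph_dom G) a -> dcl (graph_ran G) b.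
Proof.
move=> eG /dcl_graph_dom[n [phi [v [Gv va]]]].
have pa : sat phi (scons a (fst \o v)).
  by have : [set a] a by []; rewrite -va.
(* The parameters of [phi] move past the quantified variable and past the point whose uniqueness
   [uniq] asserts; being a formula, [uniq] is preserved by the extended map. *)
pose skip2 : 'I_n -> 'I_n.+2 := lift ord0 \o lift ord0.
pose uniq : formula L n.+1 :=
  All (Imp (ren phi (scons ord0 skip2)) (Equal (Var ord0) (Var (lift ord0 ord0)))).
have uniqE x (w : 'I_n -> M) : sat uniq (scons x w) <->
    forall y, sat phi (scons y w) -> y = x.
  have E y : scons y (scons x w) \o scons ord0 skip2 = scons y w.
    by rewrite comp_scons scons0; congr scons; apply/funext => i /=;
      rewrite !sconsS.
  by rewrite /uniq /=; split=> H y; move: (H y);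
    rewrite sat_ren E scons0 sconsS scons0.
apply/dclP.
rewrite (_ : [set b] = [set y | sat phi (scons y (snd \o v))]).
  by apply: defset_sat => i; exists (v i).
have pb : sat phi (scons b (snd \o v)) by apply/(elemU_sat phi eG Gv).
have /uniqE ub : sat uniq (scons b (snd \o v)).
  apply/(elemU_sat uniq eG Gv)/uniqE => y py.
  have : [set y | sat phi (scons y (fst \o v))] y by [].
  by rewrite va.
by apply/seteqP; split=> [_ ->//|y /ub].
Qed.

Lemma elem_dcl_dom G a b : elem (G `|` [set (a, b)]) ->
  dcl (graph_ran G) b -> dcl (graph_dom G) a.
Proof.
move=> /elem_inv; rewrite graph_invU => /elem_dcl_ran.
by rewrite graph_dom_inv graph_ran_inv.
Qed.

Definition concat n m (v : 'I_n -> M * M) (w : 'I_m -> M * M) (i : 'I_(n + m)) :=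
  match fintype.split i with inl j => v j | inr j => w j end.

Lemma concat_l n m (v : 'I_n -> M * M) (w : 'I_m -> M * M) (g : M * M -> M) :
  (g \o concat v w) \o @lshift n m = g \o v.
Proof.
by apply/funext => i; rewrite /concat /= -/(fintype.unsplit (inl i)) unsplitK.
Qed.

Lemma concat_r n m (v : 'I_n -> M * M) (w : 'I_m -> M * M) (g : M * M -> M) :
  (g \o concat v w) \o @rshift n m = g \o w.
Proof.
by apply/funext => i; rewrite /concat /= -/(fintype.unsplit (inr i)) unsplitK.
Qed.

Lemma concat_in G n m (v : 'I_n -> M * M) (w : 'I_m -> M * M) :
  (forall i, G (v i)) -> (forall i, G (w i)) -> forall i, G (concat v w i).
Proof. by move=> Gv Gw i; rewrite /concat; case: fintype.split. Qed.

(** The formula defining [a] isolates its type over the domain, so any solution of the transported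
    formula is a suitable image. *)
Lemma elem_extend_dcl G a : elem G -> dcl (graph_dom G) a ->
  exists b, elem (G `|` [set (a, b)]).
Proof.
move=> eG /dcl_graph_dom[n [phi [v [Gv va]]]].
have pa : sat phi (scons a (fst \o v)).
  by have : [set a] a by []; rewrite -va.
have [b pb] : exists b, sat phi (scons b (snd \o v)).
  apply: contrapT => nb.
  have : sat (All (Neg phi)) (snd \o v) by move=> b pb; apply: nb; exists b.
  by move/(eG _ (All (Neg phi)) v Gv) => /(_ a); apply.
exists b; apply: elemU => m psi w Gw psia.
pose chi := All (Imp (ren phi (up_ren (@lshift n m)))
                     (ren psi (up_ren (@rshift n m)))).
have : sat chi (snd \o concat v w).
  apply/(eG _ chi _ (concat_in Gv Gw)); rewrite /chi /= => x.
  rewrite !sat_ren !scons_up_ren concat_l concat_r => px.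
  have : [set x | sat phi (scons x (fst \o v))] x by [].
  by rewrite va => ->.
rewrite /chi /= => /(_ b); rewrite !sat_ren !scons_up_ren concat_l concat_r.
exact.
Qed.

Lemma elem_dfn G (P : (nat -> M) -> Prop) (e : nat -> M * M) : elem G ->
  (forall j, G (e j)) ->
  @dfn L unit (fun=> M) set0 (fun _ e => P e) -> P (fst \o e) -> P (snd \o e).
Proof.
move=> eG Ge [n [phi [t [ht Pt]]]].
have /choice[j tj] : forall i, exists j, t i = fun i e => e j.
  by move=> i; case: (ht i) => // -[].
have PE e' : P e' <-> sat phi (e' \o j).
  rewrite (Pt tt e') (_ : (fun i => _) = e' \o j) //.
  by apply/funext => i; rewrite tj.
by rewrite !PE => he; apply/(eG _ phi (e \o j) (fun i => Ge (j i))).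
Qed.

End Elementary.

(** * Well-orders with small initial segments *)

Definition strict_well_order (T : Type) (W : T -> T -> Prop) : Prop :=
  (forall A : set T, A !=set0 -> exists2 z, A z & forall x, A x -> ~ W x z) /\
  forall x y, [\/ W x y, x = y | W y x].

Lemma strict_well_order_exists (T : Type) :
  exists W : T -> T -> Prop, strict_well_order W.
Proof.
have [R woR] := well_ordering_principle {classic T}.
have minR (A : set T) : A !=set0 -> exists2 z, A z & forall x, A x -> R z x.
  move=> [x Ax].
  have [|z [[/asboolP Az zmin] _]] := woR [pred x | `[< A x >]].
    by exists x; apply/asboolP.
  by exists z => // y Ay; apply: zmin; apply/asboolP.
have refl x : R x x by have [|z -> h] := minR [set x]; [exists x|exact: h].
have anti x y : R x y -> R y x -> x = y.
  move=> xy yx.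
  have [|z [_ zu]] := woR [pred z | `[< z = x \/ z = y >]].
    by exists x; apply/asboolP; left.
  transitivity z; [apply/esym|]; apply: zu; split.
  - by apply/asboolP; left.
  - by move=> t /asboolP[->|->].
  - by apply/asboolP; right.
  - by move=> t /asboolP[->|->].
exists (fun x y => R x y /\ x <> y); split.
  move=> A /minR[z Az zmin]; exists z => // x Ax [xz]; apply.
  by apply: anti => //; apply: zmin.
move=> x y; have [->|xy] := pselect (x = y); first by constructor 2.
have [|z [->|->] h] := minR [set x; y]; first by exists x; left.
  by constructor 1; split=> //; apply: h; right.
by constructor 3; split; [apply: h; left|exact/nesym].
Qed.

Lemma strict_well_order_wf (T : Type) (W : T -> T -> Prop) :
  strict_well_order W -> well_founded W.
Proof.
move=> [Wmin _] x; apply: contrapT => nx.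
have [|z nz zmin] := Wmin [set x | ~ Acc W x]; first by exists x.
by apply: nz; constructor => y yz; apply: contrapT => /zmin.
Qed.

(** If some initial segment of a well-order is not small, take the least [x0] with such a segment.
    Then [T] injects into the segment below [x0], and the order pulled back along the injection has
    small initial segments. *)
Lemma small_well_order (T : Type) : exists W : T -> T -> Prop,
  strict_well_order W /\ forall x, small [set y | W y x].
Proof.
have [W [Wmin Wtot]] := strict_well_order_exists T.
have [smW|] := pselect (forall x, small [set y | W y x]); first by exists W.
move=> /existsNP[x1 nx1].
have [|x0 nx0 x0min] := Wmin [set x | ~ small [set y | W y x]]; first by exists x1.
have /card_leP[g] : [set: T] #<= [set y | W y x0] by apply: contrapT.
pose h (x : T) : T := \val (g (to_setT x)).
have hW x : W (h x) x0 by have := valP (g (to_setT x)); rewrite inE.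
have hinj : injective h.
  move=> x y /val_inj gxy.
  have : to_setT x = to_setT y by apply: ('inj_g) gxy; rewrite in_setT.
  by move/(congr1 \val).
exists (fun x y => W (h x) (h y)); split; first split.
- move=> A [x Ax]; have [|_ [z Az <-] zmin] := Wmin (h @` A).
    by exists (h x); exists x.
  by exists z => // y Ay; apply: zmin; exists y.
- move=> x y; case: (Wtot (h x) (h y)) => [|/hinj|];
  by [constructor 1|constructor 2|constructor 3].
- move=> x le; have : small [set y | W y (h x)].
    by apply: contrapT => /x0min; apply.
  apply; apply: card_le_trans le _.
  rewrite -(card_le_eql (inj_card_eq (in2W hinj))).
  by apply: subset_card_le => _ [y yx <-].
Qed.

(** * Isomorphisms preserve formulas *)

Lemma iso_sat L (M N : structure L) (g : M -> N) : is_iso g ->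
  forall n (phi : formula L n) v, sat phi v <-> sat phi (g \o v).
Proof.
move=> [[g' gK g'K] gf gr].
have geval n (t : term L n) v : g (eval v t) = eval (g \o v) t.
  elim: t => //= m s a IH; rewrite gf; congr (fint N s).
  exact/funext.
move=> n phi; elim: phi => {n} [n|n t u|n m r a|n p IHp q IHq|n p IHp] v //=.
- by rewrite -!geval; split=> [->|/(can_inj gK)].
- rewrite gr (_ : g \o _ = fun i => eval (g \o v) (a i)) //.
  by apply/funext => i /=; rewrite geval.
- by rewrite IHp IHq.
- split=> H x; first by rewrite -(g'K x) -comp_scons -IHp.
  by rewrite IHp comp_scons.
Qed.

Lemma iso_elem_equiv L (M N : structure L) : isomorphic M N -> elem_equiv M N.
Proof.
move=> [g isog]; apply/seteqP; split=> phi;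
  by rewrite /theory_of /= /holds (iso_sat isog)
    (ord0_fun_eq (g \o _) (tnth [tuple])).
Qed.

(** * Definable closure and back-and-forth *)

Section Geometry.
Variables (L : language) (lt : rsym L 2) (M : structure L).
Variable lambda : Type.
Hypothesis inacc : strongly_inaccessible lambda.
Hypothesis Mlambda : [set: M] #= [set: lambda].
Hypothesis satM : saturated M.
Hypothesis dloM : dense_linear_order lt M.
Hypothesis lorM : forall A (X : set M), defset A X -> least_or_ray lt X.
Variables (k : nat) (f : 'I_k -> M -> M).
Hypothesis f_definable : forall i, definable0_fun (f i).
Hypothesis dclE : forall A : set M,
  dcl A = \bigcup_(i : 'I_k) (f i @` A) `|` dcl (set0 : set M).
Implicit Types A B X Y : set M.
Local Notation "x <o y" := (slt lt x y) (at level 70).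

Let irr (x : M) : ~ x <o x. Proof. by have [irr _ _ _] := dloM; apply: irr. Qed.
Let tr (x y z : M) : x <o y -> y <o z -> x <o z.
Proof. by have [_ tr _ _] := dloM; apply: tr. Qed.
Let tot (x y : M) : [\/ x <o y, x = y | y <o x].
Proof. by have [_ _ tot _] := dloM; apply: tot. Qed.
Let dns (x y : M) : x <o y -> exists z, x <o z /\ z <o y.
Proof. by have [_ _ _ dns] := dloM; apply: dns. Qed.
Let leP (x y : M) : ~ x <o y -> y = x \/ y <o x.
Proof. by case: (tot x y); auto. Qed.
Let eq_of_not_lt (x y : M) : ~ x <o y -> ~ y <o x -> x = y.
Proof. by case: (tot x y). Qed.

Lemma dfn_fun A j t u : atom (S := fun=> M) (consts A) t ->
  atom (S := fun=> M) (consts A) u ->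
  @dfn L unit (fun=> M) (consts A) (fun i e => u i e = f j (t i e)).
Proof.
move=> ht hu; have [phi phiP] := f_definable j.
by apply: dfn_ext (dfn_sat2 phi ht hu) _ => i e; apply: phiP.
Qed.

Ltac dfn_solve := apply: dfn_defset; dfn_tac; try (apply: dfn_fun; dfn_atom).

Lemma dcl0_sub A : dcl (set0 : set M) `<=` dcl A.
Proof. by apply: dclW. Qed.

Lemma dcl_f A i a : dcl A a -> dcl A (f i a).
Proof.
move=> /dclP dAa; apply/dclP.
rewrite (_ : [set _] = [set y | exists z, [set a] z /\ y = f i z]); last first.
  by apply/seteqP; split=> [y ->|y [z [-> ->]]//]; exists a.
dfn_solve.
Qed.

Lemma dcl_dcl A : dcl (dcl A) `<=` dcl A.
Proof.
move=> b; rewrite {1}dclE => -[[i _ [c Ac <-]]|]; first exact: dcl_f.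
exact: dcl0_sub.
Qed.

Lemma dcl_sub_dcl A B : A `<=` dcl B -> dcl A `<=` dcl B.
Proof. by move=> AB b /(dclW AB)/dcl_dcl. Qed.

(** By [dclE], a new point [c] brings at most [k] points outside the old closure. *)
Lemma dcl1 A c b : dcl (A `|` [set c]) b -> dcl A b \/ exists i, b = f i c.
Proof.
rewrite dclE => -[[i _ [x [Ax|->] <-]]|]; last 1 first.
- by left; apply: dcl0_sub.
- by left; apply/dcl_f/sub_dcl.
- by right; exists i.
Qed.

Lemma defsetD A X Y : defset A X -> defset A Y -> defset A (X `\` Y).
Proof. by move=> dX dY; dfn_solve. Qed.

Lemma finite_sub_dcl_defset A F : finite_set F -> F `<=` dcl A -> defset A F.
Proof.
move: F; apply: finite_set_ind => [_|a F _ IH aF]; first by dfn_solve.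
have da : defset A [set a] by apply/dclP/aF; left.
have dF : defset A F by apply: IH => x Fx; apply: aF; right.
dfn_solve.
Qed.

(** If [m] is the least point of the finite set [X] outside dcl(A), the points of [X] below it are
    definable over [A], so [m] is definable as the least of the remaining ones. *)
Lemma acl_dcl A b : acl A b -> dcl A b.
Proof.
move=> /aclP[X [dX finX Xb]]; apply: contrapT => nb.
have [||m [Xm nm] mmin] := @finite_minimal M (@slt L lt M) (X `\` dcl A) irr tr.
- exact: finite_setD.
- by exists b.
apply: nm; pose F := X `&` [set x | x <o m].
have dF : defset A F.
  apply: finite_sub_dcl_defset; first exact: finite_setIl.
  move=> x [Xx xm]; apply: contrapT => nx; exact: mmin xm.
apply/dclP.
rewrite (_ : [set m] =
    [set x | (X x /\ ~ F x) /\ forall y, X y /\ ~ F y -> ~ y <o x]).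
  dfn_solve.
have mle y : X y -> ~ F y -> ~ y <o m by move=> Xy nFy ym; apply: nFy.
have nFm : ~ F m by case=> _ /irr.
apply/seteqP; split=> [_ ->|x /= [[Xx nFx] xmin]].
  by split=> // y [Xy nFy]; apply: mle.
by apply: eq_of_not_lt; [exact: mle|exact: xmin].
Qed.

Lemma infinite_of_notin_dcl A X a : defset A X -> X a -> ~ dcl A a ->
  infinite_set X.
Proof. by move=> dX Xa na finX; apply/na/acl_dcl/aclP; exists X. Qed.

(** The point is chosen in all complements in [X] of finite sets definable over [A]; if it were in
    dcl(A), its singleton would be one of these sets. *)
Lemma infinite_notin_dcl A X : small A -> defset A X -> infinite_set X ->
  exists2 a, X a & ~ dcl A a.
Proof.
move=> smA dX infX.
pose B := [set X `\` F | F in [set F | finite_set F /\ defset A F]].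
have [|_ [F [finF dF] <-]|x xB] := saturated_directed satM smA (B := B).
- split.
  + exists (X `\` set0), set0 => //; split; first exact: finite_set0.
    by apply: finite_sub_dcl_defset; [exact: finite_set0|].
  + by move=> _ [F [finF _] <-]; apply/infinite_setN0/infinite_setD.
  + move=> _ _ [F [finF dF] <-] [G [finG dG] <-]; exists (X `\` (F `|` G)).
      exists (F `|` G) => //; split; first by rewrite finite_setU.
      by dfn_solve.
    by move=> y [Xy nFG]; split; split=> // ?; apply: nFG; [left|right].
- exact: defsetD.
exists x.
  have [|//] := xB (X `\` set0); exists set0 => //; split.
    exact: finite_set0.
  by apply: finite_sub_dcl_defset; [exact: finite_set0|].
move=> dx; have [] := xB (X `\` [set x]); last by move=> _; apply.
by exists [set x] => //; split=> //; apply: finite_set1.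
Qed.

Definition has_interval X : Prop :=
  exists c d, c <o d /\ forall x, c <o x -> x <o d -> X x.

Let ray_interval X : (exists c d, c <o d /\ forall x, x <o d -> X x) ->
  has_interval X.
Proof. by move=> [c [d [cd dX]]]; exists c, d; split=> // x _; apply: dX. Qed.

(* If [X] has no interval, each element of [X] has a successor in [X], with
   which it is interdefinable over [A]; so an element of [X] outside [dcl A]
   would have infinitely many elements in its closure over [A], against [dclE]. *)
Lemma infinite_has_interval A X : small A -> defset A X -> infinite_set X ->
  has_interval X.
Proof.
move=> smA dX infX; apply: contrapT => nX.
have succ a : (exists x, X x /\ a <o x) ->
    exists s, (X s /\ a <o s) /\ forall x, X x /\ a <o x -> ~ x <o s.
  move=> Xa; have dXa : defset (A `|` [set a]) [set x | X x /\ a <o x].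
    dfn_solve.
  case: (lorM dXa Xa) => [//|[[e [d [ed [edX _]]]]|/ray_interval[c [d [cd cdX]]]]].
    by case: nX; exists e, d; split=> // x ex xd; case: (edX x ex xd).
  by case: nX; exists c, d; split=> // x cx xd; case: (cdX x cx xd).
have [a Xa na] := infinite_notin_dcl smA dX infX.
(* [P] is finite by [dcl1]. The contradiction is that the successor in [X] of its greatest element
   [m] lies in [P] again. *)
pose P := X `&` (dcl (A `|` [set a]) `\` dcl A).
have finP : finite_set P.
  apply: (@sub_finite_set _ _ ((fun i => f i a) @` [set: 'I_k])).
    by move=> x [_ [/dcl1[//|[i ->]] _]]; exists i.
  exact/finite_image/finite_finset.
have [||||m [Xm [dm nm]] mmax] := @finite_minimal M (fun x y => y <o x) P => //.
- by move=> x y z yx zy; apply: tr zy yx.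
- by exists a; split=> //; split=> //; apply: sub_dcl; right.
have [|s [[Xs ms] sleast]] := succ m.
  (* Without a successor, [m] would be the greatest element of [X], hence in dcl(A). *)
  apply: contrapT => mmax'; apply: nm; apply/dclP.
  rewrite (_ : [set m] = [set x | X x /\ forall y, X y -> ~ x <o y]).
    dfn_solve.
  have nlt y : X y -> ~ m <o y by move=> Xy my; apply: mmax'; exists y.
  apply/seteqP; split=> [_ ->//|x [Xx xmax]].
  by apply: eq_of_not_lt; [exact: xmax|exact: nlt].
have sdcl : dcl (A `|` [set m]) s.
  apply/dclP.
  rewrite (_ : [set s] = [set x | (X x /\ m <o x) /\
      forall y, X y /\ m <o y -> ~ y <o x]).
    dfn_solve.
  apply/seteqP; split=> [_ ->//|x [[Xx mx] xleast]].
  by apply: eq_of_not_lt; [exact: sleast|exact: xleast].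
have mdcl : dcl (A `|` [set s]) m.
  apply/dclP.
  rewrite (_ : [set m] = [set x | (X x /\ x <o s) /\
      forall y, X y /\ y <o s -> ~ x <o y]).
    dfn_solve.
  have mle y : X y -> y <o s -> ~ m <o y.
    by move=> Xy ys my; apply: sleast ys.
  apply/seteqP; split=> [_ ->|x [[Xx xs] xmax]].
    by split=> // y [Xy ys]; apply: mle.
  by apply: eq_of_not_lt; [exact: xmax|exact: mle].
apply: (mmax s) => //; split=> //; split.
  move: sdcl; apply: dcl_sub_dcl => x [Ax|->//].
  by apply: sub_dcl; left.
move=> ds; apply: nm; move: mdcl; apply: dcl_sub_dcl => x [Ax|->//].
exact: sub_dcl.
Qed.

Lemma has_interval_of_notin_dcl A X a : small A -> defset A X -> X a ->
  ~ dcl A a -> has_interval X.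
Proof.
move=> smA dX Xa na.
by apply: (infinite_has_interval smA dX); apply: infinite_of_notin_dcl na.
Qed.

(** Saturation is used twice: over [A] for a common left endpoint [c], then over [A] and [c] for a
    common right endpoint. Both families are directed because endpoints valid for a subset remain
    valid for the larger set. *)
Lemma common_interval A (B : set (set M)) : small A -> B !=set0 ->
    (forall X Y, B X -> B Y -> exists2 Z, B Z & Z `<=` X `&` Y) ->
    B `<=` defset A -> (forall X, B X -> has_interval X) ->
  exists c d, c <o d /\ forall X, B X -> forall x, c <o x -> x <o d -> X x.
Proof.
move=> smA [X0 BX0] Bdir Bdef Bint.
pose left_end X := [set c | exists d, c <o d /\ forall x, c <o x -> x <o d -> X x].
have [||c cB] := saturated_directed satM smA (B := left_end @` B).
- split; first by exists (left_end X0); exists X0.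
    by move=> _ [X BX <-]; have [c [d cdX]] := Bint X BX; exists c, d.
  move=> _ _ [X BX <-] [Y BY <-]; have [Z BZ ZXY] := Bdir X Y BX BY.
  exists (left_end Z); first by exists Z.
  by move=> c [d [cd dZ]]; split; exists d; split=> // x cx xd;
    have [] := ZXY x (dZ x cx xd).
- move=> _ [X BX <-]; have dX := Bdef X BX; rewrite /left_end; dfn_solve.
pose right_end X := [set d | c <o d /\ forall x, c <o x -> x <o d -> X x].
have smAc : small (A `|` [set c]).
  by apply: (smallU inacc Mlambda) => //; apply: (small_finite inacc Mlambda);
    apply: finite_set1.
have [||d dB] := saturated_directed satM smAc (B := right_end @` B).
- split; first by exists (right_end X0); exists X0.
    move=> _ [X BX <-]; have [|d cdX] := cB (left_end X); first by exists X.
    by exists d.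
  move=> _ _ [X BX <-] [Y BY <-]; have [Z BZ ZXY] := Bdir X Y BX BY.
  exists (right_end Z); first by exists Z.
  by move=> d [cd dZ]; split; split=> // x cx xd; have [] := ZXY x (dZ x cx xd).
- move=> _ [X BX <-]; have dX := Bdef X BX; rewrite /right_end; dfn_solve.
exists c, d; split; first by have [|] := dB (right_end X0); first by exists X0.
by move=> X BX; have [|] := dB (right_end X); first by exists X.
Qed.

Let dns_min (e d d' : M) : e <o d -> e <o d' ->
  exists x, [/\ e <o x, x <o d & x <o d'].
Proof.
move=> ed ed'; have [dd'|/leP dd'] := pselect (d <o d').
  by have [x [ex xd]] := dns ed; exists x; split=> //; apply: tr dd'.
have [x [ex xd]] := dns ed'; exists x; split=> //.
by case: dd' => [<-//|]; apply: tr.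
Qed.

(* The left endpoints of the maximal intervals of constancy of [f i] form a
   0-definable set without interval, hence a finite subset of [dcl set0]. *)
Lemma exchange i a : ~ dcl set0 (f i a) -> dcl [set f i a] a.
Proof.
move=> nh; apply: contrapT => na.
have sm1 (x : M) : small [set x].
  by apply: (small_finite inacc Mlambda); apply: finite_set1.
set h := f i a in nh na.
(* As [a] is outside dcl(h), the fibre of [f i] through [a] contains an interval (c,d). *)
have dX : defset [set h] [set x | h = f i x] by dfn_solve.
have [c [d [cd cdh]]] := has_interval_of_notin_dcl (sm1 h) dX erefl na.
pose E := [set e | exists d, e <o d /\
  (exists y, forall x, e <o x -> x <o d -> y = f i x) /\
  forall e', e' <o e -> ~ exists y, forall x, e' <o x -> x <o d -> y = f i x].
have Edcl : E `<=` dcl set0.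
  have dE : defset set0 E by rewrite /E; dfn_solve.
  suff finE : finite_set E by move=> e Ee; apply/acl_dcl/aclP; exists E.
  apply: contrapT => infE.
  have [|u [v [uv uvE]]] := infinite_has_interval _ dE infE.
    by apply: (small_finite inacc Mlambda); apply: finite_set0.
  have [e1 [ue1 e1v]] := dns uv.
  have [d1 [ed1 [[y1 y1P] _]]] := uvE e1 ue1 e1v.
  have [e2 [e12 e2d e2v]] := dns_min ed1 e1v.
  have [d2 [ed2 [[y2 y2P] e2min]]] := uvE e2 (tr ue1 e12) e2v.
  (* The constancy intervals starting at [e1] and [e2] overlap, so [f i] is constant from [e1] to
     [d2], against the choice of [e2] in [E]. *)
  apply: (e2min e1 e12); exists y1 => x e1x xd2.
  have [xd1|/leP d1x] := pselect (x <o d1); first exact: y1P.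
  have d1d2 : d1 <o d2 by case: d1x => [->//|/tr]; apply.
  have e2x : e2 <o x by case: d1x => [<-//|]; apply: tr.
  have [w [e2w wd1]] := dns e2d.
  rewrite -(y2P x) // (y1P w) //; last exact: tr e2w.
  by rewrite -(y2P w) //; apply: tr d1d2.
(* The value of [f i] just to the right of [e] is definable from [e], so it cannot be [h] when [e]
   is in dcl(empty). *)
have const_end e : dcl set0 e ->
    ~ exists d, e <o d /\ forall x, e <o x -> x <o d -> h = f i x.
  move=> de [d0 [ed0 d0h]]; apply: nh; apply/dcl_dcl.
  have : dcl [set e] h; last by apply: dclW => x ->.
  apply/dclP; rewrite (_ : [set h] =
      [set y | exists d, e <o d /\ forall x, e <o x -> x <o d -> y = f i x]).
    by dfn_solve.
  apply/seteqP; split=> [_ ->|y [d' [ed' yP]]]; first by exists d0.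
  have [x [ex xd0 xd']] := dns_min ed0 ed'.
  by rewrite /= (d0h x) // (yP x).
(* [S] measures how far to the left the value [h] persists below [d]. A least element of [S] belongs
   to [E], hence to dcl(empty), which [const_end] forbids. *)
pose S := [set z | z <o d /\ forall x, z <o x -> x <o d -> h = f i x].
have const_least e : S e -> (forall z, S z -> ~ z <o e) -> False.
  move=> [ed eh] eS; apply: (const_end e); last by exists d.
  apply: Edcl; exists d; split=> //; split; first by exists h.
  move=> e' e'e [y yP]; apply: (eS e') => //; split; first exact: tr ed.
  move=> x e'x xd; have [w [ew wd]] := dns ed.
  by rewrite (eh w) // -(yP w) ?(yP x) //; apply: tr ew.
have dS : defset ([set h] `|` [set d]) S by rewrite /S; dfn_solve.
have [|[m [Sm mS]]|[[e [d0 [ed0 [d0S eS]]]]|[c0 [d0 [cd0 d0S]]]]] := lorM dS.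
- by exists c.
- exact: const_least mS.
(* An open left end [e] of [S] is itself in [S], since points of [S] lie arbitrarily close to [e] on
   its right. *)
- apply: const_least eS; have [z [ez zd0]] := dns ed0.
  have [zd _] := d0S z ez zd0; split; first exact: tr zd.
  move=> x ex xd; have [w [ew wx wd0]] := dns_min ex ed0.
  by have [_] := d0S w ew wd0; apply.
- have hray x w : w <o x -> x <o d -> h = f i x.
    move=> wx xd; have [wd0|/leP d0w] := pselect (w <o d0).
      by have [_] := d0S w wd0; apply.
    have c0x : c0 <o x by apply: tr cd0 _; case: d0w => [->//|/tr]; apply.
    by have [_] := d0S c0 cd0; apply.
  (* Here [h] is the value of [f i] towards the left end of the order. The guard [exists w] leaves
     out a possible least element, where the value is not controlled. *)
  apply: nh; apply/dclP; rewrite (_ : [set h] = [set y | exists c d, c <o d /\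
      forall x, (exists w, w <o x) -> x <o d -> y = f i x]).
    by dfn_solve.
  apply/seteqP; split=> [_ ->|y [c1 [d1 [cd1 yP]]]].
    by exists c, d; split=> // x [w wx] xd; apply: hray wx xd.
  have [x [cx xd]] := dns cd; have [z [cz zd1]] := dns cd1.
  have [xz|/leP zx] := pselect (x <o z).
    rewrite /= (hray _ _ cx xd) (yP x) //; first by exists c.
    exact: tr zd1.
  rewrite /= (yP z) //; last by exists c1.
  rewrite (hray z c1) //; by case: zx => [->//|/tr]; apply.
Qed.

(** * Back-and-forth *)

Definition small_graph (G : set (M * M)) : Prop :=
  small (graph_dom G) /\ small (graph_ran G).

Let small1 (x : M) : small [set x].
Proof. by apply: (small_finite inacc Mlambda); apply: finite_set1. Qed.

Lemma small_graphU G a b : small_graph G -> small_graph (G `|` [set (a, b)]).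
Proof.
by move=> [sd sr]; split; rewrite ?graph_domU ?graph_ranU;
  apply: (smallU inacc Mlambda) => //; apply: small1.
Qed.

Lemma small_graph_inv G : small_graph G -> small_graph (graph_inv G).
Proof.
by move=> [sd sr]; split; rewrite ?graph_dom_inv ?graph_ran_inv.
Qed.

(* The formulas over [graph_ran G] corresponding to [tp (a / graph_dom G)]
   have intervals, so they share one. *)
Lemma interval_extensions G a : small_graph G -> elem G ->
    ~ dcl (graph_dom G) a ->
  exists c d, c <o d /\
    forall b, c <o b -> b <o d -> elem (G `|` [set (a, b)]).
Proof.
move=> [smd smr] eG na.
pose B := [set X | exists n (phi : formula L n.+1) (v : 'I_n -> M * M),
  [/\ forall i, G (v i), sat phi (scons a (fst \o v)) &
      X = [set x | sat phi (scons x (snd \o v))]]].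
have [||||c [d [cd cdB]]] := @common_interval _ B smr.
- exists [set x | sat (Neg (Bot 1))
      (scons x (snd \o (tnth [tuple] : 'I_0 -> M * M)))].
  by exists 0, (Neg (Bot 1)), (tnth [tuple]); split=> // -[].
- move=> _ _ [n [phi [v [Gv pv ->]]]] [m [psi [w [Gw pw ->]]]].
  pose chi := Neg (Imp (ren phi (up_ren (@lshift n m)))
                       (Neg (ren psi (up_ren (@rshift n m))))).
  have chiE (g : M * M -> M) x : sat chi (scons x (g \o concat v w)) <->
      sat phi (scons x (g \o v)) /\ sat psi (scons x (g \o w)).
    rewrite /chi /= !sat_ren !scons_up_ren concat_l concat_r.
    by split=> [h|[h1 h2] /(_ h1)//]; split; apply: contrapT => h';
      apply: h => // ?; case: h'.
  exists [set x | sat chi (scons x (snd \o concat v w))]; last by move=> x /chiE.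
  exists (n + m), chi, (concat v w); split=> //; first exact: concat_in.
  exact/chiE.
- move=> _ [n [phi [v [Gv _ ->]]]]; apply: defset_sat => i; by exists (v i).
- move=> _ [n [phi [v [Gv pv ->]]]].
  have dphi : defset (graph_dom G) [set x | sat phi (scons x (fst \o v))].
    by apply: defset_sat => i; exists (v i).
  have := has_interval_of_notin_dcl smd dphi pv na.
  case: n phi v Gv {pv dphi} => [|n] phi v Gv.
    by rewrite (ord0_fun_eq (fst \o v) (snd \o v)).
  (* Containing an interval is a first-order condition on the parameters, so it passes from the
     domain of [G] to its range. *)
  pose P (e : nat -> M) := has_interval
    [set x | sat phi (scons x (fun i : 'I_n.+1 => e i))].
  pose e (j : nat) := v (inord j).
  have Pe (g : M * M -> M) :
      P (g \o e) = has_interval [set x | sat phi (scons x (g \o v))].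
    rewrite /P (_ : (fun i => _) = g \o v) //.
    by apply/funext => i; rewrite /e /= inord_val.
  rewrite -!Pe; apply: (elem_dfn eG) => [j|]; first exact: Gv.
  rewrite /P /has_interval /=; dfn_tac.
  have := @dfn_sat L unit (fun=> M) set0 _ phi
    (scons (fun _ e => e 0) (fun (i : 'I_n.+1) _ e => e i.+3)).
  move=> /(_ _)/dfn_ext; apply.
    by move=> i; case: (unliftP ord0 i) => [j ->|->];
      rewrite ?sconsS ?scons0; apply: atom_var.
  move=> u e'; set w := (fun i => _).
  rewrite (_ : w = scons (e' 0) (fun i : 'I_n.+1 => e' i.+3)) //.
  by apply/funext => i; rewrite /w; case: (unliftP ord0 i) => [j ->|->];
    rewrite ?sconsS ?scons0.
exists c, d; split=> // b cb bd; apply: elemU => n phi v Gv pv.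
by apply: (cdB [set x | sat phi (scons x (snd \o v))]) cb bd; exists n, phi, v.
Qed.

(** For [a] in the closure of the domain, [b] is its image under the only possible elementary
    extension. The predicates are thus compared on the whole closure, while [G] itself need not be
    closed. *)
Definition good (D D' : set M) G : Prop := elem G /\
  forall a b, dcl (graph_dom G) a -> elem (G `|` [set (a, b)]) -> (D a <-> D' b).

Lemma good_inv D D' G : good D D' G -> good D' D (graph_inv G).
Proof.
move=> [eG gG]; split; first exact: elem_inv.
move=> b a; rewrite graph_dom_inv => db eba; apply: iff_sym; apply: gG.
  apply: (@elem_dcl_dom _ _ _ a b) db.
  by move: (elem_inv eba); rewrite graph_invU graph_invK.
by move: (elem_inv eba); rewrite graph_invU graph_invK.
Qed.

Lemma good_dcl D D' G a : good D D' G -> dcl (graph_dom G) a ->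
  exists b, good D D' (G `|` [set (a, b)]).
Proof.
move=> [eG gG] da; have [b eab] := elem_extend_dcl eG da.
exists b; split=> // a' b'; rewrite graph_domU => da' eab'; apply: gG.
  by move: da'; apply: dcl_sub_dcl => x [Gx|->//]; apply: sub_dcl.
by apply: elem_sub eab' => x [Gx|]; [left; left|right].
Qed.

(** The points to check are the [f i a]. If [a] is in [D], such a point is in [D] exactly when it
    equals [a]. If [a] is outside dcl(D), it is never in [D], since exchange would put [a] into
    dcl(D). The same holds for [b] and [D']. *)
Lemma good_new D D' G a b :
    H_properties lt f D -> H_properties lt f D' -> good D D' G ->
    elem (G `|` [set (a, b)]) ->
    (D a /\ D' b) \/ (~ dcl D a /\ ~ dcl D' b) ->
  good D D' (G `|` [set (a, b)]).
Proof.
move=> [D0 Df _ _] [D'0 D'f _ _] [eG gG] eab ab; split=> // a' b'.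
rewrite graph_domU => da' eab'.
have eab'0 : elem (G `|` [set (a', b')]).
  by apply: elem_sub eab' => x [Gx|]; [left; left|right].
have [|na'] := pselect (dcl (graph_dom G) a'); first by move/gG; apply.
have [//|[i fa]] := dcl1 da'.
have nb' : ~ dcl (graph_ran G) b' by move/(elem_dcl_dom eab'0).
have Gab : (G `|` [set (a, b)] `|` [set (a', b')]) (a, b) by left; right.
have Gab' : (G `|` [set (a, b)] `|` [set (a', b')]) (a', b') by right.
have fb : b' = f i b.
  have [phi phiP] := f_definable i.
  by apply/phiP; apply: (elem_pair eab' Gab Gab'); apply/phiP.
case: ab => [[Da Db]|[nDa nDb]].
  pose same : formula L 2 := Equal (Var ord0) (Var ord_max).
  have Eab : a = a' -> b = b' := elem_pair (phi := same) eab' Gab Gab'.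
  have Eba : b = b' -> a = a' :=
    elem_pair (phi := same) (elem_inv eab') Gab Gab'.
  split=> [Da'|Db'].
    by rewrite -Eab // fa Df // -fa.
  by rewrite -Eba // fb D'f // -fb.
have dclD (E : set M) x : ~ dcl E x -> ~ dcl set0 (f i x) -> ~ E (f i x).
  move=> nx nfx Efx; apply: nx; move: (exchange nfx).
  by apply: dclW => y ->.
split=> [Da'|Db'].
  case: (dclD _ _ nDa); rewrite -fa //.
  by move/dcl0_sub => h; apply: na'; exact: h.
case: (dclD _ _ nDb); rewrite -fb //.
by move/dcl0_sub => h; apply: nb'; exact: h.
Qed.

(** Inside the closure of the domain the image is forced. A point [f i h] with [h] in [D] is reached
    by adding [h] before it, with an image in [D'] by density. A point outside dcl(D) and the
    closure gets an image outside dcl(D'). *)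
Lemma good_forth D D' G a :
    H_properties lt f D -> H_properties lt f D' ->
    small_graph G -> good D D' G ->
  exists G', [/\ G `<=` G', small_graph G', good D D' G' & graph_dom G' a].
Proof.
move=> HD HD' smG gG.
have sub G1 p : G1 `<=` G1 `|` [set p] by left.
have dom_last G1 x y : graph_dom (G1 `|` [set (x, y)]) x.
  by rewrite graph_domU; right.
have dcl_case G1 : small_graph G1 -> good D D' G1 -> dcl (graph_dom G1) a ->
    exists G', [/\ G1 `<=` G', small_graph G', good D D' G' & graph_dom G' a].
  move=> sm1 g1 d1; have [b gb] := good_dcl g1 d1.
  by exists (G1 `|` [set (a, b)]); split=> //; apply: small_graphU.
have [|na] := pselect (dcl (graph_dom G) a); first exact: dcl_case.
have add_D h : D h -> ~ dcl (graph_dom G) h ->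
    exists h', good D D' (G `|` [set (h, h')]).
  move=> Dh nh; have [eG _] := gG.
  have [c [d [cd cdP]]] := interval_extensions smG eG nh.
  have [_ _ dens _] := HD'; have [h' [Dh' ch' hd']] := dens c d cd.
  by exists h'; apply: good_new => //; [exact: cdP|left].
have [|nDa] := pselect (dcl D a).
  rewrite dclE => -[[i _ [h Dh fh]]|/dcl0_sub/na//].
  have nh : ~ dcl (graph_dom G) h by move/(dcl_f i); rewrite fh.
  have [h' gh] := add_D h Dh nh.
  have [|||G' [GG' smG' gG' Ga]] := dcl_case (G `|` [set (h, h')]) => //.
  - exact: small_graphU.
  - by rewrite -fh; apply/dcl_f/sub_dcl.
  - by exists G'; split=> //; apply: subset_trans GG'.
have [eG _] := gG.
have [c [d [cd cdP]]] := interval_extensions smG eG na.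
have [_ _ _ ext] := HD'; have [b [cb bd nb]] := ext c d cd.
have eab := cdP b cb bd.
exists (G `|` [set (a, b)]); split=> //; first exact: small_graphU.
apply: good_new => //; right; split=> //.
rewrite dclE => -[[i _ [y Dy yb]]|]; first by apply: (nb i y Dy).
by move/dcl0_sub => h; apply: na; apply: (elem_dcl_dom eab); apply: h.
Qed.

Lemma good_step D D' G a :
    H_properties lt f D -> H_properties lt f D' ->
    small_graph G -> good D D' G ->
  exists G', [/\ G `<=` G', small_graph G', good D D' G',
    graph_dom G' a & graph_ran G' a].
Proof.
move=> HD HD' smG gG.
have [G1 [GG1 sm1 g1 da]] := good_forth a HD HD' smG gG.
have [G2 [G12 sm2 g2 ra]] :=
  good_forth a HD' HD (small_graph_inv sm1) (good_inv g1).
exists (graph_inv G2); split.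
- by move=> [x y] /GG1 Gxy; apply: (G12 (y, x)).
- exact: small_graph_inv.
- exact: good_inv.
- move: da => [[x y] Gxy <-]; rewrite graph_dom_inv.
  by exists (y, x) => //; apply: G12.
- by rewrite graph_ran_inv.
Qed.

Lemma chain_family (J X : Type) (F : J -> set X) (I : set J) n (v : 'I_n -> X) :
    I !=set0 -> (forall i j, I i -> I j -> F i `<=` F j \/ F j `<=` F i) ->
    (forall k, (\bigcup_(i in I) F i) (v k)) ->
  exists2 i, I i & forall k, F i (v k).
Proof.
move=> [i0 Ii0] ch; elim: n v => [|n IH] v Fv; first by exists i0 => // -[].
have [i Ii iv] := IH (fun k => v (lift ord0 k)) (fun k => Fv _).
have [j Ij jv] := Fv ord0.
have [ij|ji] := ch i j Ii Ij.
  by exists j => // l; case: (unliftP ord0 l) => [m ->|->//]; apply: ij.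
by exists i => // l; case: (unliftP ord0 l) => [m ->//|->]; apply: ji.
Qed.

(** Neither predicate meets dcl(empty), so there is nothing to match. *)
Lemma good_set0 D D' : H_properties lt f D -> H_properties lt f D' ->
  good D D' set0.
Proof.
move=> [D0 _ _ _] [D'0 _ _ _]; split; first exact: elem_set0.
move=> a b da eab; have db := elem_dcl_ran eab da.
rewrite /graph_dom /graph_ran !image_set0 in da db.
by split=> [/D0//|/D'0].
Qed.

(** Both an instance of elementarity and a definition of a point of the closure involve finitely
    many pairs, which lie in one member of the chain. *)
Lemma good_bigcup D D' (J : Type) (I : set J) (F : J -> set (M * M)) :
    H_properties lt f D -> H_properties lt f D' ->
    (forall i j, I i -> I j -> F i `<=` F j \/ F j `<=` F i) ->
    (forall i, I i -> good D D' (F i)) ->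
  good D D' (\bigcup_(i in I) F i).
Proof.
move=> HD HD' ch gF; have [->|/set0P I0] := eqVneq I set0.
  by rewrite bigcup_set0; apply: good_set0.
split.
  move=> n phi v Fv; have [i Ii iv] := chain_family I0 ch Fv.
  by have [eF _] := gF i Ii; apply: eF.
move=> a b /dcl_graph_dom[n [phi [v [Fv va]]]] eab.
have [i Ii iv] := chain_family I0 ch Fv; have [_] := gF i Ii; apply.
  apply/dclP; rewrite -va; apply: defset_sat => j; by exists (v j).
apply: elem_sub eab => x [Fx|]; [left; by exists i|by right].
Qed.

Lemma good_total D D' : H_properties lt f D -> H_properties lt f D' ->
  exists G, good D D' G /\ forall a, graph_dom G a /\ graph_ran G a.
Proof.
move=> HD HD'.
have [W [woW smW]] := small_well_order M; have wfW := strict_well_order_wf woW.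
(* [step] is total, with arbitrary values at bad inputs, so the recursion can be defined before its
   stages are known to be small and good. *)
have /choice[step stepP] : forall p : set (M * M) * M, exists G',
    small_graph p.1 -> good D D' p.1 ->
    [/\ p.1 `<=` G', small_graph G', good D D' G', graph_dom G' p.2 &
        graph_ran G' p.2].
  move=> [G a] /=; have [[smG gG]|nG] := pselect (small_graph G /\ good D D' G).
    by have [G' ?] := good_step a HD HD' smG gG; exists G'.
  by exists G => smG gG; case: nG.
pose F := Fix wfW (fun=> set (M * M)) (fun x rec =>
  step (\bigcup_(y in [set y : {y | W y x} | True]) rec (sval y) (svalP y), x)).
pose U x := \bigcup_(y in [set y | W y x]) F y.
have FE x : F x = step (U x, x).
  rewrite /F Fix_eq => [|y g g' gg']; last first.
    by congr (step (_, y)); apply: eq_bigcupr => z _; apply: gg'.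
  congr (step (_, x)); apply/seteqP; split=> p [].
    by move=> [y yx] _ /= Fp; exists y.
  by move=> y yx Fp; exists (exist _ y yx).
pose P x := [/\ forall y, W y x -> F y `<=` F x, small_graph (F x),
  good D D' (F x), graph_dom (F x) x & graph_ran (F x) x].
have chainW (I : set M) : (forall x, I x -> P x) ->
    forall x y, I x -> I y -> F x `<=` F y \/ F y `<=` F x.
  move=> IP x y Ix Iy; have [_ tot_W] := woW.
  have [Px _ _ _ _] := IP x Ix; have [Py _ _ _ _] := IP y Iy.
  by case: (tot_W x y) => [/Py|->|/Px]; [left|left|right].
have good_union (I : set M) : (forall x, I x -> P x) ->
    good D D' (\bigcup_(x in I) F x).
  move=> IP; apply: good_bigcup => // [|x /IP[]//].
  exact: chainW.
have allP : forall x, P x.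
  move=> x; elim: (wfW x) => {}x _ IH.
  (* Short initial segments and regularity keep the union of the earlier stages small. *)
  have smU : small_graph (U x).
    rewrite /small_graph /graph_dom /graph_ran /U !image_bigcup.
    by split; apply: (small_bigcup inacc Mlambda) => // y /IH[_ []].
  have gU : good D D' (U x) by exact: good_union.
  have [sub smF gF dF rF] := stepP (U x, x) smU gU.
  split; rewrite FE // => y yx; apply: subset_trans sub => p Fp.
  by exists y.
exists (\bigcup_(x in setT) F x); split; first exact: good_union.
move=> a; have [_ _ _ [p Fp pa] [q Fq qa]] := allP a.
by split; [exists p|exists q] => //; exists a.
Qed.

End Geometry.

(** * From a total elementary relation to an automorphism *)

Lemma elem_isomorphic L (M : structure L) (D D' : set M) (G : set (M * M)) :
    elem G -> (forall a, graph_dom G a) -> (forall b, graph_ran G b) ->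
    (forall a b, G (a, b) -> D a <-> D' b) ->
  isomorphic (expansion D) (expansion D').
Proof.
move=> eG Gdom Gran GD.
have /choice[g gP] a : exists b, G (a, b).
  by have [[x y] Gxy /= <-] := Gdom a; exists y.
have /choice[g' g'P] b : exists a, G (a, b).
  by have [[x y] Gxy /= <-] := Gran b; exists x.
have gv n (v : 'I_n -> M) i : G (v i, g (v i)) by [].
exists g; split.
- exists g' => x.
    exact: (elem_inj (elem_inv eG) (g'P (g x)) (gP x)).
  exact: (elem_inj eG (gP (g' x)) (g'P x)).
- move=> n s v.
  pose phi : formula L n.+1 :=
    Equal (Var ord0) (@App L n.+1 n s (fun i => Var (lift ord0 i))).
  pose w := scons (fint M s v) v.
  have wS : w \o lift ord0 = v by apply/funext => i; rewrite /w /= sconsS.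
  have fw : w ord0 = fint M s (w \o lift ord0) by rewrite wS /w scons0.
  have gw : g (w ord0) = fint M s (g \o (w \o lift ord0)).
    exact: (proj1 (eG _ phi _ (gv _ w)) fw).
  by rewrite wS /w scons0 in gw.
- move=> n [m r|] v.
    exact: (eG _ (Rel r (@Var L m)) (fun i => (v i, g (v i))) (gv _ v)).
  exact: GD.
Qed.

Theorem proposition4p3
  (L : language) (lambda : Type)
  (lambda_inaccessible : strongly_inaccessible lambda)
  (lambda_gt_L : language_card_lt L lambda)
  (T : set (sentence L))
  (T_infinite : exists2 N : structure L,
                  is_model N T & infinite_set [set: N])
  (T_o_minimal : o_minimal_theory T)
  (M : structure L) (M_monster : is_monster lambda T M)
  (k : nat) (f : 'I_k -> M -> M)
  (f_definable : forall i, definable0_fun (f i))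
  (dclE : forall A : set M,
     dcl A = \bigcup_(i : 'I_k) (f i @` A) `|` dcl (set0 : set M))
  (H : set M)
  (MH_monster : is_monster lambda (T_indep T) (expansion H)) :
  o_class H = e_class H.
Proof.
have [lt [N [dloN ominN TN]]] := T_o_minimal; subst T.
have [MT cardM satM] := M_monster; have [MH _ _] := MH_monster.
have MN : theory_of M = theory_of N := model_complete MT.
have M2 : exists x y : M, y <> x.
  have infM := monster_infinite lambda_inaccessible cardM.
  have [x _] := infinite_setN0 infM.
  have [y [_ yx]] := infinite_setN0 (infinite_setD infM (finite_set1 x)).
  by exists x, y.
have lorM A (X : set M) : defset A X -> least_or_ray lt X.
  exact: (transfer_least_or_ray dloN ominN MN M2).
have dloM : dense_linear_order lt M by exact: (transfer_dlo dloN).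
apply/seteqP; split=> D; first exact: iso_elem_equiv.
move=> HD; have MD : is_model (expansion D) (T_indep (theory_of N)).
  by rewrite /is_model -HD.
have H_H := T_indep_properties dloN MN f_definable MH.
have H_D := T_indep_properties dloN MN f_definable MD.
have [G [[eG gG] Gtot]] := good_total lambda_inaccessible cardM satM dloM lorM
  f_definable dclE H_H H_D.
apply: (elem_isomorphic eG) => [a|b|a b Gab]; [by case: (Gtot a)|by case: (Gtot b)|].
(* A pair already in [G] is a trivial extension of [G], so the matching condition of [good] applies
   to it. *)
apply: gG; first by apply: sub_dcl; exists (a, b).
by apply: elem_sub eG => p [//|->].
Qed.
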